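(* Assume that $\limsup_{x\to\infty}\frac{x\phi'(x)}{\phi(x)}<1$. Let $f(x):=-\ln\mathbb P(I>x)$, $x\ge0$, so that $f'(x)=k(x)/\mathbb P(I>x)$ for $x>0$. Then, as $x\to\infty$, $$ f'(x)=\frac{\psi(x)}{x}+\frac{\psi'(x)}{\psi(x)}-\frac1x-\frac{\psi''(x)}{2\psi'(x)}+O\left(\frac{\psi'(x)}{(\psi(x))^2}\right). $$
   Context: Let $\xi$ be a subordinator started from $0$, drift-free and unkilled, with Lévy measure $\pi$ on $(0,\infty)$, $\pi\neq 0$, $\int_0^\infty(1\wedge v)\pi(\mathrm dv)<\infty$. Its Laplace exponent is $\phi(x)=\int_0^\infty(1-e^{-xv})\pi(\mathrm dv)$, $x\ge0$, so that $\mathbb E[e^{-x\xi_t}]=e^{-t\phi(x)}$. The function $x\mapsto x/\phi(x)$ is continuous and strictly increasing from $(0,\infty)$ onto $(x_\psi,\infty)$, where $x_\psi:=\lim_{x\downarrow0}x/\phi(x)\in[0,\infty)$; $\psi:(x_\psi,\infty)\to(0,\infty)$ denotes its inverse. Both $\phi$ (on $(0,\infty)$) and $\psi$ are infinitely differentiable. The exponential functional is $I:=\int_0^\infty\exp(-\xi_r)\,\mathrm dr$; its law is known to have a density $k$ with respect to Lebesgue measure on $[0,\infty)$, infinitely differentiable on $(0,\infty)$, satisfying $k(x)=\int_0^\infty\left(\int_x^{xe^v}k(y)\,\mathrm dy\right)\pi(\mathrm dv)$ for $x>0$. *)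

(* Defs.v *)
From mathcomp Require Import all_boot all_order all_algebra.
From mathcomp Require Import all_classical all_reals all_analysis.

Set Implicit Arguments.
Unset Strict Implicit.
Unset Printing Implicit Defensive.

Import Order.TTheory GRing.Theory Num.Theory.
Import numFieldNormedType.Exports.

Local Open Scope ring_scope.
Local Open Scope classical_set_scope.

(* Lets the big-O notation be used at +oo. *)
Canonical pinfty_filter_on (R : numFieldType) :=
  FilterType (pinfty_nbhs R) (@filter_filter R _ (@proper_pinfty_nbhs R)).

(* A measure on the half-line (0, +oo) is a measure on R carried by it. *)
Definition levy_measure (R : realType) (nu : {measure set R -> \bar R}) : Prop :=
  [/\ nu `]-oo, 0%R] = 0%E,
      nu `]0%R, +oo[ != 0%E &
      (\int[nu]_(v in `]0%R, +oo[) (Num.min 1 v)%:E < +oo)%E].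

Definition laplace_exponent (R : realType) (nu : {measure set R -> \bar R})
  (x : R) : R := \int[nu]_(v in `]0, +oo[) (1 - expR (- (x * v))).

Section process.
Context (d : measure_display) (Omega : measurableType d) (R : realType).
Variables (P : probability Omega R) (xi : R -> Omega -> R).

(* Times are the nonnegative reals; xi t is irrelevant for t < 0. *)

Definition stationary_increments : Prop :=
  forall (s t : R) (B : set R), 0 <= s -> 0 <= t -> measurable B ->
    P [set w | B (xi (s + t) w - xi s w)] = P [set w | B (xi t w)].

Definition independent_increments : Prop :=
  forall (n : nat) (t : nat -> R) (B : nat -> set R),
    0 <= t 0%N -> (forall i, t i <= t i.+1) -> (forall i, measurable (B i)) ->
    P [set w | forall i, (i < n)%N -> B i (xi (t i.+1) w - xi (t i) w)]
    = (\big[*%E/1%E]_(i < n) P [set w | B i (xi (t i.+1) w - xi (t i) w)%R])%E.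

(* Being real-valued, the process is unkilled; left limits exist by
   monotonicity. *)
Record subordinator : Prop := Subordinator {
  sub_measurable : forall t : R, 0 <= t -> measurable_fun setT (xi t) ;
  sub_start : forall w, xi 0 w = 0 ;
  sub_nondecreasing :
    forall w (s t : R), 0 <= s -> s <= t -> xi s w <= xi t w ;
  sub_right_continuous :
    forall w (t : R), 0 <= t -> xi u w @[u --> t^'+] --> xi t w ;
  sub_stationary : stationary_increments ;
  sub_independent : independent_increments }.

(* The transform identity makes the Lévy measure of xi equal to nu, with drift
   and killing rate both zero. *)
Definition driftless_subordinator (nu : {measure set R -> \bar R}) : Prop :=
  subordinator /\
  forall t x : R, 0 <= t -> 0 <= x ->
    'E_P[fun w => expR (- (x * xi t w))]%E
    = (expR (- (t * laplace_exponent nu x)))%:E.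

(* Extended-real-valued, as finiteness only holds almost surely. *)
Definition exp_functional (w : Omega) : \bar R :=
  (\int[lebesgue_measure]_(r in `[0%R, +oo[) (expR (- xi r w))%:E)%E.

Definition exp_functional_tail (x : R) : R :=
  fine (P [set w | (x%:E < exp_functional w)%E]).

(* k is the version of the density of the law of exp_functional that is smooth
   on (0, +oo); density_eq is the integral equation this version is known to
   satisfy. The existence of such a k is a classical fact about exponential
   functionals of subordinators. *)
Record exp_functional_density (nu : {measure set R -> \bar R}) (k : R -> R)
    : Prop := ExpFunctionalDensity {
  density_measurable : measurable_fun (`[0, +oo[%classic : set R) k ;
  density_ge0 : forall x : R, 0 <= x -> 0 <= k x ;
  density_law : forall A : set R, measurable A ->
    P [set w | exists2 y, A y & exp_functional w = y%:E]
    = (\int[lebesgue_measure]_(y in A `&` `[0%R, +oo[) (k y)%:E)%E ;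
  density_smooth : forall n (x : R), 0 < x -> derivable (k^`(n)) x 1 ;
  density_eq : forall x : R, 0 < x ->
    (k x)%:E = (\int[nu]_(v in `]0%R, +oo[)
      \int[lebesgue_measure]_(y in `[x, (x * expR v)%R]) (k y)%:E)%E }.

End process.

(* The inverse of x |-> x / phi x on (0, +oo); it takes the junk value 0 off the
   image of that map. *)
Definition psi_of (R : realType) (phi : R -> R) (y : R) : R :=
  xget 0 [set x | 0 < x /\ x / phi x = y].

(* Main.v *)
Require Import Defs.
From mathcomp Require Import all_boot all_order all_algebra.
From mathcomp Require Import all_classical all_reals all_analysis.
From mathcomp Require Import measurable_realfun ring lra.
Set Implicit Arguments.
Unset Strict Implicit.
Unset Printing Implicit Defensive.
Import Order.TTheory GRing.Theory Num.Theory.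
Import numFieldNormedType.Exports.
Local Open Scope ring_scope.
Local Open Scope classical_set_scope.

(* Write K x = P (I > x), so that f' = k / K, and the integral equation for k
   reads - K' x = int (K x - K (x e^v)) nu(dv). This operator obeys a maximum
   principle: two vanishing functions that agree at x0 and satisfy the equation,
   resp. a strict inequality, on [x0, +oo) are ordered there, hence so are their
   derivatives at x0. As x0 is arbitrary, a positive strict sub- or
   supersolution h near +oo gives k / K <= - h' / h, resp. >=, pointwise.

   Put s u = psi (e^u) and p = s + n + C r, where n is the second-order
   correction of the theorem and r = s' / s^2. With h (e^u) = exp (- int p), a
   Taylor expansion of the exponent gives, for y = s u,
     p u / e^u - int (1 - exp (- int_u^(u+v) p)) nu(dv) = (C + O(1)) phi y / y^2,
   where O(1) does not depend on C. So C large makes h a strict subsolution and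
   - C large a strict supersolution, and the two bounds differ by
   O(r u / e^u) = O(psi' / psi^2). The limsup hypothesis bounds
   1 / (1 - y phi' y / phi y), hence s', s'', n, n', r, r' by multiples of
   s, s, 1, 1, 1 / s, 1 / s. *)

(** * Calculus and the maximum principle *)

(** In the variable [u = ln x] a jump from [x] to [x e^v] is a shift by [v], so only upward
    increments of the exponent [g], [g' = p], enter; this is why the comparison needs data only at
    [x0] and at infinity. The corrections come from a balance. With [y = s u] and [e^u = y / phi y],
    the left side is [p phi y / y], while to leading orders the integral is [phi y + (n + C r) phi'
    y - s' phi'' y / 2]. The terms [phi y] cancel, [n] solves [n (phi y / y - phi' y) = - s' phi'' y
    / 2], and [r = s' / s^2] makes [C r (phi y / y - phi' y)] equal to [C phi y / y^2]. Both
    corrections have explicit primitives in [u]: [ln (phi s - s phi' s) / 2] for [n] and [- 1 / s]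
    for [r]. The delicate point is the order of quantifiers: [C] must exceed an error constant
    computed for a trial function that contains [C]. Since [r = O(1 / s)], every [C] in the error is
    absorbed once [s] exceeds a multiple of [|C|], so that only the threshold in [x] depends on
    [C]. *)

Lemma is_derive_continuous (R : realType) (f : R -> R) (x l : R) :
  is_derive x 1 f l -> {for x, continuous f}.
Proof. by move=> [df _]; exact/differentiable_continuous/derivable1_diffP. Qed.

Lemma is_derive_within (R : realType) (f df : R -> R) (a b : R) :
  (forall x, a <= x <= b -> is_derive x 1 f (df x)) ->
  {within `[a, b], continuous f}.
Proof.
move=> fd; apply: continuous_in_subspaceT => x; rewrite inE /= in_itv /= => xab.
exact: is_derive_continuous (fd _ xab).
Qed.

Lemma MVT_closed (R : realType) (f df : R -> R) (a b : R) :
  a <= b -> (forall x, a <= x <= b -> is_derive x 1 f (df x)) ->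
  exists2 c, a <= c <= b & f b - f a = df c * (b - a).
Proof.
move=> ab fd; have [||c] := @MVT_segment R f df a b ab.
- by move=> x; rewrite in_itv /= => /andP[ax xb]; apply: fd; rewrite !ltW.
- exact: is_derive_within fd.
- by rewrite in_itv /= => cab ->; exists c.
Qed.

Lemma derive_ge0_le (R : realType) (f df : R -> R) (a b : R) :
  a <= b -> (forall x, a <= x <= b -> is_derive x 1 f (df x)) ->
  (forall x, a <= x <= b -> 0 <= df x) -> f a <= f b.
Proof.
move=> ab fd f0; have [c cab e] := MVT_closed ab fd.
by rewrite -subr_ge0 e mulr_ge0 ?subr_ge0 ?f0.
Qed.

Lemma derive_norm_le (R : realType) (f df : R -> R) (a b B : R) :
  a <= b -> (forall x, a <= x <= b -> is_derive x 1 f (df x)) ->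
  (forall x, a <= x <= b -> `|df x| <= B) -> `|f b - f a| <= B * (b - a).
Proof.
move=> ab fd fB; have [c cab ->] := MVT_closed ab fd.
rewrite normrM (ger0_norm (_ : 0 <= b - a)) ?subr_ge0//.
by rewrite ler_wpM2r ?subr_ge0 ?fB.
Qed.

(** Two applications of the mean value theorem; the lost factor 1/2 is harmless below. *)
Lemma taylor1_bound (R : realType) (f f1 f2 : R -> R) (a v B : R) :
  0 <= v ->
  (forall x, a <= x <= a + v -> is_derive x 1 f (f1 x)) ->
  (forall x, a <= x <= a + v -> is_derive x 1 f1 (f2 x)) ->
  (forall x, a <= x <= a + v -> `|f2 x| <= B) ->
  `|f (a + v) - f a - v * f1 a| <= B * v ^+ 2.
Proof.
move=> v0 fd1 fd2 fB.
have av : a <= a + v by rewrite lerDl.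
have B0 : 0 <= B by apply: le_trans (fB a _) => //; rewrite lexx.
have [c /andP[ac cv] ->] := MVT_closed av fd1.
have -> : f1 c * (a + v - a) - v * f1 a = v * (f1 c - f1 a) by ring.
rewrite normrM (ger0_norm v0) expr2 mulrCA ler_wpM2l//.
have sub x : a <= x <= c -> a <= x <= a + v.
  by move=> /andP[-> /le_trans->].
apply: (le_trans (derive_norm_le ac (fun x h => fd2 x (sub x h))
  (fun x h => fB x (sub x h)))).
by rewrite ler_wpM2l//; lra.
Qed.

(** [G] is [f] minus its Taylor terms of degree one and two at [a], so its derivative [G1] is the
    first-order remainder of [f1], which [taylor1_bound] controls. *)
Lemma taylor2_bound (R : realType) (f f1 f2 f3 : R -> R) (a v B : R) :
  0 <= v ->
  (forall x, a <= x <= a + v -> is_derive x 1 f (f1 x)) ->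
  (forall x, a <= x <= a + v -> is_derive x 1 f1 (f2 x)) ->
  (forall x, a <= x <= a + v -> is_derive x 1 f2 (f3 x)) ->
  (forall x, a <= x <= a + v -> `|f3 x| <= B) ->
  `|f (a + v) - f a - v * f1 a - v ^+ 2 / 2 * f2 a| <= B * v ^+ 3.
Proof.
move=> v0 fd1 fd2 fd3 fB.
have av : a <= a + v by rewrite lerDl.
have B0 : 0 <= B by apply: le_trans (fB a _) => //; rewrite lexx.
pose G x := f x - (x - a) * f1 a - (x - a) ^+ 2 / 2 * f2 a.
pose G1 x := f1 x - f1 a - (x - a) * f2 a.
have Gd x : a <= x <= a + v -> is_derive x 1 G (G1 x).
  move=> xav; have := fd1 _ xav => ?.
  apply: is_derive_eq; rewrite /G1 /GRing.scale/=; lra.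
have := derive_norm_le (B := B * v ^+ 2) av Gd.
have -> : G (a + v) - G a = f (a + v) - f a - v * f1 a - v ^+ 2 / 2 * f2 a.
  by rewrite /G; ring.
have -> : B * v ^+ 2 * (a + v - a) = B * v ^+ 3 by ring.
apply => x /andP[ax xv].
have sub y : a <= y <= a + (x - a) -> a <= y <= a + v.
  by rewrite addrC subrK => /andP[-> /le_trans->].
have xa0 : 0 <= x - a by rewrite subr_ge0.
have := taylor1_bound xa0 (fun y h => fd2 y (sub y h))
  (fun y h => fd3 y (sub y h)) (fun y h => fB y (sub y h)).
rewrite (addrC a) subrK => /le_trans; apply.
by rewrite ler_wpM2l// lerXn2r ?nnegrE//; lra.
Qed.

(** The ordering is known only to the right of [x], so the derivative of [a - b] is computed from
    right difference quotients, which are nonpositive. *)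
Lemma is_derive_touching_le (R : realType) (a b : R -> R) (x la lb : R) :
  is_derive x 1 a la -> is_derive x 1 b lb -> a x = b x ->
  (forall y, x <= y -> a y <= b y) -> la <= lb.
Proof.
move=> da db abx ab.
have [dd dE] : is_derive x 1 (a - b) (la - lb) by apply: is_deriveB.
rewrite -subr_le0 -dE ['D_1 _ x]cvg_at_rightE; last exact: dd.
apply: limr_le.
  rewrite -(cvg_at_rightE
    (fun h : R => h^-1 *: (((a - b) \o shift x) (h *: 1) - (a - b) x)))//.
  apply: cvg_trans dd; apply: cvg_app => A [e egt0 Ae].
  by exists e => // y ye ygt0; apply: Ae => //; exact/lt0r_neq0.
near=> h.
have h0 : 0 < h by near: h; exact: nbhs_right_gt.
rewrite /= /GRing.scale/= mulr1 pmulr_rle0 ?invr_gt0//.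
rewrite -[(a - b) _]/(a (h + x) - b (h + x)) -[(a - b) x]/(a x - b x).
by rewrite abx subrr subr0 subr_le0 ab// lerDr ltW.
Unshelve. all: end_near. Qed.

(* Maximum principle: at a positive maximum [y] of [a - b] the derivatives
   agree, while every upward jump of [a] costs at least as much as the same jump
   of [b]. *)
Lemma comparison_principle (R : realType) (a b a' b' : R -> R) (x0 : R) :
  (forall y, x0 <= y -> is_derive y 1 a (a' y)) ->
  (forall y, x0 <= y -> is_derive y 1 b (b' y)) ->
  a x0 <= b x0 ->
  (forall e, 0 < e -> exists B, forall y, B <= y -> a y - b y < e) ->
  (forall y, x0 < y ->
     (forall z, y < z -> b y - b z <= a y - a z) -> a' y <> b' y) ->
  forall y, x0 <= y -> a y <= b y.
Proof.
move=> da db ab0 lim jump y1 xy1; rewrite leNgt; apply/negP => bay.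
pose d y := a y - b y.
have d1 : 0 < d y1 by rewrite subr_gt0.
have [B0 HB] := lim _ d1.
(* Beyond [B] the difference stays below [d y1], so its maximum over [[x0, B]] is a maximum over the
   whole half-line, attained in the interior. *)
pose B := Num.max B0 (y1 + 1).
have y1B : y1 < B by rewrite /B lt_max; apply/orP; right; lra.
have x0B : x0 <= B by apply: le_trans xy1 (ltW y1B).
have dd y : x0 <= y -> is_derive y 1 d (a' y - b' y).
  by move=> xy; have := da _ xy => ?; have := db _ xy => ?; exact: is_deriveB.
have [|c + cmax] := @EVT_max R d x0 B x0B.
  by apply: is_derive_within => x /andP[/dd + _]; exact.
rewrite in_itv /= => /andP[x0c cB].
have y1c : d y1 <= d c by apply: cmax; rewrite in_itv /= xy1 ltW.
have gmax z : x0 <= z -> d z <= d c.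
  move=> x0z; have [zB|Bz] := leP z B.
    by apply: cmax; rewrite in_itv /= x0z.
  rewrite (le_trans _ y1c)// ltW// HB//.
  by rewrite (le_trans _ (ltW Bz))// /B le_max lexx.
have x0c' : x0 < c.
  rewrite lt_neqAle x0c andbT; apply/eqP => E.
  by move: (lt_le_trans d1 y1c); rewrite -E /d subr_gt0 ltNge ab0.
have cB' : c < B.
  rewrite lt_neqAle cB andbT; apply/eqP => E.
  by move: y1c; rewrite leNgt HB// E /B le_max lexx.
apply: (jump c x0c').
  move=> z cz; have : d z <= d c by apply: gmax; rewrite ltW// (lt_trans x0c').
  by rewrite /d; lra.
have dc0 : is_derive c 1 d 0.
  apply: (@derive1_at_max R d x0 B c x0B).
  - by move=> t; rewrite in_itv /= => /andP[/ltW/dd[]].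
  - by rewrite in_itv /= x0c'.
  - by move=> t; rewrite in_itv /= => /andP[/ltW/gmax].
have [_ E] := dd _ x0c; move: dc0 => [_ E0].
by apply/eqP; rewrite -subr_eq0 -E E0.
Qed.

(** This is [t^(n+1) / (n+1)! <= e^t - 1] multiplied by [e^-t]. With [t = y v] it trades each factor
    [v] under the integral for a factor [1 / y], with [1 - e^(-y v)] as common weight. *)
Lemma exprM_expRN_le (R : realType) (n : nat) (t : R) : 0 <= t ->
  t ^+ n.+1 * expR (- t) <= (n.+1)`!%:R * (1 - expR (- t)).
Proof.
move=> t0.
have E : expR t * expR (- t) = 1 by rewrite -expRD subrr expR0.
have e0 := expR_gt0 (- t).
have F0 : (0 : R) < (n.+1)`!%:R by rewrite ltr0n fact_gt0.
have := expR_ge1Dxn n t0; rewrite -lerBrDl ler_pdivrMr// => H.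
have -> : 1 - expR (- t) = (expR t - 1) * expR (- t) by rewrite mulrBl E mul1r.
by rewrite mulrA (ler_wpM2r (ltW e0))// mulrC.
Qed.

(** With [q = - T], all follows from [1 + q <= e^q] and from [e^q - 1 <= q e^q], which is
    [1 - q <= e^-q]. The one-sided hypothesis is there because later [T = D - y v] may be negative,
    but not below [- v]. *)
Lemma expRN_taylor (R : realType) (w T : R) : 0 <= w -> - w <= T ->
  `|expR (- T) - 1 + T| <= expR w * T ^+ 2.
Proof.
move=> w0 wT; pose q := - T.
have q1 := expR_ge1Dx q; have q2 := expR_ge1Dx (- q).
have E : expR q * expR (- q) = 1 by rewrite -expRD subrr expR0.
have eq0 := expR_gt0 q.
have q3 : expR q - 1 <= q * expR q by nra.
have ew1 : 1 <= expR w by rewrite -expR0 ler_expR.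
have eqw : expR q <= expR w by rewrite ler_expR /q; lra.
have -> : expR (- T) - 1 + T = expR q - 1 - q by rewrite /q; ring.
have -> : T ^+ 2 = q ^+ 2 by rewrite /q sqrrN.
rewrite ger0_norm; last lra.
have [q0|q0] := leP 0 q.
  have : expR q - 1 - q <= q * (q * expR q) by nra.
  move=> /le_trans; apply; have : 0 <= q ^+ 2 by rewrite sqr_ge0.
  nra.
have : expR q - 1 - q <= q ^+ 2 by nra.
by move=> /le_trans; apply; rewrite ler_peMl ?sqr_ge0.
Qed.

(** * The Laplace exponent and its derivatives *)

Section laplace_exponent_theory.
Context (R : realType) (nu : {measure set R -> \bar R}).
Hypothesis hnu : levy_measure nu.

Let D : set R := `]0, +oo[.
Local Notation phi := (laplace_exponent nu).

(** For [n >= 1] this is [(-1)^(n-1)] times the n-th derivative of [phi]. For [n = 0] the integral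
    may diverge at [v = 0], hence integrability is stated for [n.+1]. *)
Definition laplace_moment (n : nat) (y : R) : R :=
  \int[nu]_(v in `]0, +oo[) (v ^+ n * expR (- (y * v))).
Local Notation phi_ := laplace_moment.

Let mD : measurable D. Proof. exact: measurable_itv. Qed.

Let DE (v : R) : D v = (0 < v). Proof. by rewrite /D /= in_itv /= andbT. Qed.

Lemma levy_integrable_min : nu.-integrable D (fun v => (Num.min 1 v)%:E).
Proof.
case: hnu => _ _ H; apply/integrableP; split.
  apply/measurable_EFinP; apply: measurable_minr => //; exact: measurable_id.
rewrite (eq_integral (fun v : R => (Num.min 1 v)%:E))// => v.
by rewrite inE DE => v0; rewrite abse_EFin ger0_norm// le_min ler01 ltW.
Qed.

Lemma one_sub_expRN_ge0 (t : R) : 0 <= t -> 0 <= 1 - expR (- t).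
Proof. by move=> t0; rewrite subr_ge0 -expR0 ler_expR oppr_le0. Qed.

Lemma one_sub_expRN_gt0 (t : R) : 0 < t -> 0 < 1 - expR (- t).
Proof. by move=> t0; rewrite subr_gt0 -expR0 ltr_expR oppr_lt0. Qed.

Lemma measurable_expRNM (y : R) (E : set R) :
  measurable_fun E (fun v => expR (- (y * v))).
Proof.
apply: measurable_funTS; apply: continuous_measurable_fun => v.
have : is_derive v 1 (fun v : R => expR (- (y * v))) (- y * expR (- (y * v))).
  by apply: is_derive_eq; rewrite /GRing.scale/=; ring.
exact: is_derive_continuous.
Qed.

Lemma levy_integrable_exp (y : R) : 0 <= y ->
  nu.-integrable D (fun v => (1 - expR (- (y * v)))%:E).
Proof.
move=> y0; apply: (@le_integrable _ _ _ nu _ mD _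
    (fun v => ((1 + y) * Num.min 1 v)%:E)).
- by apply/measurable_EFinP; apply: measurable_funB => //; exact: measurable_expRNM.
- move=> v; rewrite DE => v0; rewrite !abse_EFin lee_fin.
  rewrite ger0_norm; last by rewrite one_sub_expRN_ge0 ?mulr_ge0 ?(ltW v0).
  apply: le_trans _ (ler_norm _); have := expR_ge1Dx (- (y * v)).
  have := expR_gt0 (- (y * v)).
  by case: (leP 1 v) => v1; nra.
- under eq_fun do rewrite EFinM.
  exact: integrableZl levy_integrable_min.
Qed.

Lemma levy_dominated_integrable (f : R -> R) (y c : R) : 0 <= y ->
  measurable_fun D f ->
  (forall v, 0 < v -> `|f v| <= c * (1 - expR (- (y * v)))) ->
  nu.-integrable D (EFin \o f).
Proof.
move=> y0 mf fc; apply: (@le_integrable _ _ _ nu _ mD _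
    (fun v => (c * (1 - expR (- (y * v))))%:E)).
- exact/measurable_EFinP.
- move=> v; rewrite DE => v0; rewrite !abse_EFin lee_fin.
  exact: le_trans (fc _ v0) (ler_norm _).
- under eq_fun do rewrite EFinM.
  exact: integrableZl (levy_integrable_exp y0).
Qed.

(** The weight [1 - e^(-y v)] has integral [phi y], so pointwise bounds against it become bounds
    relative to [phi y]. *)
Lemma levy_dominated_le (f : R -> R) (y c : R) : 0 <= y ->
  measurable_fun D f ->
  (forall v, 0 < v -> `|f v| <= c * (1 - expR (- (y * v)))) ->
  `|\int[nu]_(v in D) f v| <= c * phi y.
Proof.
move=> y0 mf fc; have intf := levy_dominated_integrable y0 mf fc.
apply: (le_trans (le_normr_Rintegral mD intf)).
rewrite /laplace_exponent -RintegralZl//; last exact: levy_integrable_exp.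
apply: le_Rintegral => //.
- exact: (integrable_norm intf).
- rewrite (_ : _ \o _ = fun v => (c%:E * (1 - expR (- (y * v)))%:E)%E)//.
  exact: integrableZl (levy_integrable_exp y0).
- by move=> v; rewrite DE => /fc.
Qed.

Lemma moment_dominated (n : nat) (y v : R) : 0 < y -> 0 < v ->
  `|v ^+ n.+1 * expR (- (y * v))|
  <= (n.+1)`!%:R / y ^+ n.+1 * (1 - expR (- (y * v))).
Proof.
move=> y0 v0; rewrite ger0_norm; last first.
  by rewrite mulr_ge0 ?expR_ge0// exprn_ge0// ltW.
rewrite mulrAC ler_pdivlMr ?exprn_gt0// mulrAC -exprMn (mulrC v).
by apply: exprM_expRN_le; rewrite mulr_ge0// ltW.
Qed.

Lemma measurable_moment (n : nat) (y : R) (E : set R) :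
  measurable_fun E (fun v => v ^+ n * expR (- (y * v))).
Proof.
by apply: measurable_funM; [exact: exprn_measurable|exact: measurable_expRNM].
Qed.

Lemma moment_integrable (n : nat) (y : R) : 0 < y ->
  nu.-integrable D (fun v => (v ^+ n.+1 * expR (- (y * v)))%:E).
Proof.
move=> y0; apply: (levy_dominated_integrable (ltW y0)).
  exact: measurable_moment.
by move=> v v0; exact: moment_dominated.
Qed.

Lemma moment_ge0 (n : nat) (y : R) : 0 <= phi_ n y.
Proof.
apply: Rintegral_ge0 => v /=; rewrite in_itv /= andbT => v0.
by rewrite mulr_ge0 ?expR_ge0// exprn_ge0// ltW.
Qed.

Lemma moment_le (n : nat) (y : R) : 0 < y ->
  y ^+ n.+1 * phi_ n.+1 y <= (n.+1)`!%:R * phi y.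
Proof.
move=> y0; rewrite mulrC -ler_pdivlMr ?exprn_gt0// mulrAC.
apply: le_trans (ler_norm _) _; apply: (levy_dominated_le (ltW y0)).
  exact: measurable_moment.
by move=> v v0; exact: moment_dominated.
Qed.

(** A zero integral would make the positive [f] vanish almost everywhere, so the half-line would be
    a null set, against [levy_measure]. *)
Lemma levy_integral_gt0 (f : R -> R) : nu.-integrable D (EFin \o f) ->
  (forall v, 0 < v -> 0 < f v) -> 0 < \int[nu]_(v in D) f v.
Proof.
move=> intf f0.
have I0 : 0 <= \int[nu]_(v in D) f v.
  by apply: Rintegral_ge0 => v; rewrite DE => /f0/ltW.
rewrite lt_neqAle I0 andbT eq_sym; apply/eqP => E.
have mf : measurable_fun D (EFin \o f) by exact: measurable_int intf.
case: hnu => _ /eqP + _; apply.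
have [N [mN N0 DN]] : ae_eq nu D (EFin \o f) (cst 0%E).
  apply/ae_eq_integral_abs => //.
  rewrite (eq_integral (EFin \o f)); last first.
    by move=> v; rewrite inE DE => /f0 fv /=; rewrite ger0_norm// ltW.
  by rewrite -(fineK (integrable_fin_num mD intf)) -/(Rintegral _ _ _) E.
apply/eqP; rewrite -measure_le0 -N0 le_measure ?inE// => v.
rewrite -/(D v) DE => v0; apply: DN => /= H.
have Dv : D v by rewrite DE.
by have [fv] := H Dv; move: (f0 _ v0); rewrite fv ltxx.
Qed.

Lemma laplace_exponent_gt0 (y : R) : 0 < y -> 0 < phi y.
Proof.
move=> y0; apply: levy_integral_gt0.
  exact: levy_integrable_exp (ltW y0).
by move=> v v0; rewrite one_sub_expRN_gt0// mulr_gt0.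
Qed.

(** The integrand is [1 - e^-t - t e^-t] with [t = y v], positive because [1 + t < e^t]. This
    positivity is what makes [y / phi y] strictly increasing. *)
Lemma laplace_exponent_sub_moment_gt0 (y : R) :
  0 < y -> 0 < phi y - y * phi_ 1 y.
Proof.
move=> y0; have i1 := levy_integrable_exp (ltW y0).
have i2 := moment_integrable 0 y0.
have i3 : nu.-integrable D (EFin \o (fun v => y * (v ^+ 1 * expR (- (y * v))))).
  rewrite (_ : _ \o _ = fun v => (y%:E * (v ^+ 1 * expR (- (y * v)))%:E)%E)//.
  exact: integrableZl.
rewrite /laplace_exponent /laplace_moment -RintegralZl// -RintegralB//.
apply: levy_integral_gt0.
  exact: (integrableB mD i1 i3).
move=> v v0; have := expR_ge1Dxn 1 (ltW (mulr_gt0 y0 v0)).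
have yv0 := mulr_gt0 y0 v0; have := expR_ge1Dx (y * v).
have : expR (y * v) * expR (- (y * v)) = 1 by rewrite -expRD subrr expR0.
have := expR_gt0 (- (y * v)); set t := y * v in yv0 *.
have : 1 + t < expR t by apply: expR_gt1Dx; rewrite gt_eqF.
by rewrite expr1 mulrA -/t; nra.
Qed.

(** Differentiation is localised to []y / 2, y * 2[], so a dominating function depending on [y / 2]
    suffices. [G] has to be nonnegative on all of [R], which is why the uses below take powers of
    [|v|]. *)
Lemma is_derive_under_integral (f df : R -> R -> R) (G : R -> R) (y : R) :
  0 < y ->
  (forall x, 0 < x -> nu.-integrable D (EFin \o f x)) ->
  (forall x v : R, is_derive x 1 (f ^~ v) (df x v)) ->
  nu.-integrable D (EFin \o G) -> (forall v, 0 <= G v) ->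
  (forall x v, y / 2 < x -> 0 < v -> `|df x v| <= G v) ->
  is_derive y 1 (fun x => \int[nu]_(v in D) f x v) (\int[nu]_(v in D) df y v).
Proof.
move=> y0 intf fd intG G0 fG.
have E x v : partial1of2 f x v = df x v.
  by rewrite partial1of2E; have [_ ->] := fd x v.
have Iy : `]y / 2, y * 2[%classic y by rewrite /= in_itv /=; lra.
have p1 x : `]y / 2, y * 2[%classic x -> nu.-integrable D (EFin \o f x).
  by rewrite /= in_itv /= => /andP[yx _]; apply: intf; lra.
have p2 x v : `]y / 2, y * 2[%classic x -> D v -> derivable (f ^~ v) x 1.
  by move=> _ _; have [] := fd x v.
have p3 x v : `]y / 2, y * 2[%classic x -> D v -> `|partial1of2 f x v| <= G v.
  by rewrite /= in_itv /= => /andP[yx _]; rewrite DE E => v0; exact: fG.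
split; first exact: (derivable_under_integral mD Iy p1 p2 G0 intG p3).
rewrite -derive1E (differentiation_under_integral mD Iy p1 p2 G0 intG p3).
by apply: eq_Rintegral => v _; rewrite -E.
Qed.

Lemma is_derive_laplace_exponent (y : R) :
  0 < y -> is_derive y 1 phi (phi_ 1 y).
Proof.
move=> y0; rewrite /laplace_exponent /laplace_moment.
have y20 : 0 < y / 2 by rewrite divr_gt0.
apply: (@is_derive_under_integral (fun y v => 1 - expR (- (y * v)))
  (fun y v => v ^+ 1 * expR (- (y * v)))
  (fun v => `|v| ^+ 1 * expR (- (y / 2 * v))) y y0).
- by move=> x /ltW x0; exact: levy_integrable_exp.
- move=> x v; apply: is_derive_eq; rewrite /GRing.scale/=; ring.
- apply: (eq_integrable mD _ _ _ (moment_integrable 0 y20)) => v.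
  by rewrite inE DE => v0 /=; rewrite gtr0_norm.
- by move=> v; rewrite mulr_ge0 ?expR_ge0// exprn_ge0.
- move=> x v yx v0; rewrite normrM normrX (ger0_norm (expR_ge0 _)).
  by rewrite ler_wpM2l ?exprn_ge0// ler_expR lerN2 ler_wpM2r ?ltW.
Qed.

Lemma is_derive_laplace_moment (n : nat) (y : R) :
  0 < y -> is_derive y 1 (phi_ n.+1) (- phi_ n.+2 y).
Proof.
move=> y0; rewrite /laplace_moment.
have y20 : 0 < y / 2 by rewrite divr_gt0.
rewrite -mulN1r -RintegralZl//; last exact: moment_integrable.
apply: (@is_derive_under_integral (fun y v => v ^+ n.+1 * expR (- (y * v)))
  (fun y v => - 1 * (v ^+ n.+2 * expR (- (y * v))))
  (fun v => `|v| ^+ n.+2 * expR (- (y / 2 * v))) y y0).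
- by move=> x x0; exact: moment_integrable.
- move=> x v; apply: is_derive_eq; rewrite /GRing.scale/= (exprS v n.+1); ring.
- apply: (eq_integrable mD _ _ _ (moment_integrable n.+1 y20)) => v.
  by rewrite inE DE => v0 /=; rewrite gtr0_norm.
- by move=> v; rewrite mulr_ge0 ?expR_ge0// exprn_ge0.
- move=> x v yx v0; rewrite mulN1r normrN normrM normrX (ger0_norm (expR_ge0 _)).
  by rewrite ler_wpM2l ?exprn_ge0// ler_expR lerN2 ler_wpM2r ?ltW.
Qed.

End laplace_exponent_theory.

(** * The inverse function psi *)

Lemma is_derive_div (R : realType) (f g : R -> R) (x df dg : R) :
  g x != 0 -> is_derive x 1 f df -> is_derive x 1 g dg ->
  is_derive x 1 (fun y => f y / g y) ((df * g x - f x * dg) / g x ^+ 2).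
Proof.
move=> g0 dfx dgx; have := is_deriveV g0 dgx => dV.
by apply: is_derive_eq; rewrite /GRing.scale/=; field.
Qed.

(** [e] is one minus an eventual upper bound of [y phi' / phi]. Starting at [y0 >= 2] ensures
    [s - 1 >= s / 2] and [s - 1 >= 1] in the later estimates. *)
Lemma laplace_limsup_lt1 (R : realType) (nu : {measure set R -> \bar R}) :
  levy_measure nu ->
  (limf_esup (fun x : R =>
     (x * (laplace_exponent nu)^`()%classic x / laplace_exponent nu x)%:E)
     (pinfty_nbhs R) < 1)%E ->
  exists e y0 : R, [/\ 0 < e <= 1, 2 <= y0 & forall y, y0 <= y ->
    e * laplace_exponent nu y
    <= laplace_exponent nu y - y * laplace_moment nu 1 y].
Proof.
move=> hnu; set g := fun x : R => _.
rewrite limf_esupE => /ereal_inf_lt[_ /= [V [M [Mr MV]] <-] Vlt].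
have [q q01 gq] : exists2 q : R, 0 <= q < 1 & forall y, V y -> (g y <= q%:E)%E.
  have gS y : V y -> (g y <= ereal_sup (g @` V))%E.
    by move=> Vy; apply: ereal_sup_ubound; exists y.
  move: Vlt gS; case: (ereal_sup _) => [r| |] //= r1 gS.
    (* The maximum with [0] ensures [e = 1 - q <= 1]. *)
    exists (Num.max 0 r).
      by rewrite le_max lexx /= gt_max ltr01 -lte_fin.
    by move=> y /gS /le_trans; apply; rewrite lee_fin le_max lexx orbT.
  exists 0; first by rewrite lexx ltr01.
  by move=> y /gS /le_trans; apply; rewrite leNye.
exists (1 - q), (Num.max 2 (M + 1)); split.
- by lra.
- by rewrite le_max lexx.
move=> y; rewrite ge_max => /andP[y2 My].
have y0 : 0 < y by lra.
have Vy : V y by apply: MV; lra.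
have p0 := laplace_exponent_gt0 hnu y0.
suff : y * laplace_moment nu 1 y / laplace_exponent nu y <= q.
  by rewrite ler_pdivrMr// => ?; nra.
have [_ <-] := is_derive_laplace_exponent hnu y0.
by rewrite -derive1E -lee_fin; exact: gq.
Qed.

Section inverse.
Context (R : realType) (nu : {measure set R -> \bar R}).
Hypothesis hnu : levy_measure nu.
Context (e y0 : R).
Hypothesis e01 : 0 < e <= 1.
Hypothesis y02 : 2 <= y0.

Local Notation phi := (laplace_exponent nu).
Local Notation phi_ := (laplace_moment nu).
Local Notation psi := (psi_of phi).

Hypothesis eta_ge : forall y, y0 <= y -> e * phi y <= phi y - y * phi_ 1 y.

#[local] Opaque laplace_exponent laplace_moment.

Let e_gt0 : 0 < e. Proof. by case/andP: e01. Qed.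
Let y0_gt0 : 0 < y0. Proof. by apply: lt_le_trans y02. Qed.

Lemma is_derive_ratio (y : R) : 0 < y ->
  is_derive y 1 (fun y => y / phi y) ((phi y - y * phi_ 1 y) / phi y ^+ 2).
Proof.
move=> yp; have p0 := laplace_exponent_gt0 hnu yp.
have := is_derive_laplace_exponent hnu yp => d1.
have := is_derive_div (lt0r_neq0 p0) (@is_derive_id _ _ y 1) d1.
by rewrite mul1r.
Qed.

Lemma ratio_lt (y z : R) : 0 < y -> y < z -> y / phi y < z / phi z.
Proof.
move=> yp yz.
have dX x : y <= x <= z ->
    is_derive x 1 (fun y => y / phi y) ((phi x - x * phi_ 1 x) / phi x ^+ 2).
  by move=> /andP[yx _]; apply: is_derive_ratio; exact: lt_le_trans yx.
have [c /andP[yc cz] E] := MVT_closed (ltW yz) dX.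
have cp : 0 < c := lt_le_trans yp yc.
rewrite -subr_gt0 E mulr_gt0 ?subr_gt0// divr_gt0 ?exprn_gt0//.
  exact: laplace_exponent_sub_moment_gt0.
exact: laplace_exponent_gt0.
Qed.

Lemma ratio_inj (y z : R) : 0 < y -> 0 < z -> y / phi y = z / phi z -> y = z.
Proof.
move=> yp zp E; case: (ltgtP y z) => [H|H|->].
- by have := ratio_lt yp H; rewrite E ltxx.
- by have := ratio_lt zp H; rewrite E ltxx.
- by [].
Qed.

Lemma psi_ratio (y : R) : 0 < y -> psi (y / phi y) = y.
Proof.
move=> yp; rewrite /psi_of; case: xgetP => [z _ [zp E]|/(_ y)[]//].
exact: ratio_inj.
Qed.

(** The logarithmic derivative of [y / phi y] is [(phi y - y phi' y) / (y phi y) >= e / y]: the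
    ratio grows at least like [y^e]. *)
Lemma ratio_growth (y : R) : y0 <= y ->
  ln (y0 / phi y0) + e * (ln y - ln y0) <= ln (y / phi y).
Proof.
move=> yy.
rewrite mulrBr addrA addrAC -lerBrDr.
apply: (@derive_ge0_le R (fun y => ln (y / phi y) - e * ln y)
  (fun y => (phi y - y * phi_ 1 y) / phi y ^+ 2 / (y / phi y) - e / y)) => //.
  move=> x /andP[yx _]; have xp := lt_le_trans y0_gt0 yx.
  have p0 := laplace_exponent_gt0 hnu xp.
  have := is_derive1_ln (divr_gt0 xp p0) => dl.
  have := is_derive1_ln xp => dl2.
  have := @is_derive1_comp _ (@ln R) (fun y => y / phi y) x _ _ dl
    (is_derive_ratio xp) => dd.
  have dd' : is_derive x 1 (fun y => ln (y / phi y))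
      ((x / phi x)^-1 * ((phi x - x * phi_ 1 x) / phi x ^+ 2)) by exact: dd.
  by apply: is_derive_eq; rewrite /GRing.scale/=; field; rewrite !lt0r_neq0.
move=> x /andP[yx _]; have xp := lt_le_trans y0_gt0 yx.
have p0 := laplace_exponent_gt0 hnu xp.
have := eta_ge yx; set eta := phi x - x * phi_ 1 x => H.
have -> : eta / phi x ^+ 2 / (x / phi x) - e / x = (eta - e * phi x) / (x * phi x).
  by field; rewrite !lt0r_neq0.
by rewrite divr_ge0 ?subr_ge0// mulr_ge0// ltW.
Qed.

Lemma ratio_unbounded (M : R) : exists2 y, y0 <= y & M <= y / phi y.
Proof.
have yp := y0_gt0; have p0 := laplace_exponent_gt0 hnu yp.
have X0 := divr_gt0 yp p0.
(* The maximum makes [M'] positive and [t] nonnegative; [t] is the logarithmic distance from [y0] at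
   which [ratio_growth] reaches [ln M']. *)
pose M' := Num.max M (y0 / phi y0).
have M'0 : 0 < M' by rewrite lt_max X0 orbT.
pose t := (ln M' - ln (y0 / phi y0)) / e.
have t0 : 0 <= t.
  rewrite divr_ge0 ?subr_ge0 ?(ltW e_gt0)//.
  by rewrite ler_ln ?posrE// le_max lexx orbT.
have [y yE] : exists y, y = y0 * expR t by exists (y0 * expR t).
have yy : y0 <= y by rewrite yE ler_peMr ?(ltW yp)// -expR0 ler_expR.
exists y; first exact: yy.
have yp' := lt_le_trans yp yy.
have := ratio_growth yy.
have -> : ln y - ln y0 = t.
  by rewrite yE lnM ?posrE ?expR_gt0// expRK addrAC subrr add0r.
have -> : e * t = ln M' - ln (y0 / phi y0).
  by rewrite /t mulrC divfK// lt0r_neq0.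
have p1 := divr_gt0 yp' (laplace_exponent_gt0 hnu yp').
rewrite addrC subrK ler_ln ?posrE; [|exact: M'0|exact: p1].
by apply: le_trans; rewrite le_max lexx.
Qed.

(** The intermediate value theorem supplies a preimage above [y0], so [psi x] is not the default
    value. *)
Lemma psi_spec (x : R) : y0 / phi y0 <= x -> y0 <= psi x /\ psi x / phi (psi x) = x.
Proof.
move=> x0; have [y1 y01 xy1] := ratio_unbounded x.
have [||c] := @IVT R (fun y => y / phi y) y0 y1 x y01.
- apply: is_derive_within => z /andP[zy _].
  by apply: is_derive_ratio; exact: lt_le_trans zy.
- by rewrite ge_min le_max; apply/andP; split; apply/orP;
    [left; exact: x0|right; exact: xy1].
rewrite in_itv /= => /andP[yc _] <-.
by rewrite psi_ratio //; exact: lt_le_trans yc.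
Qed.

Lemma is_derive_psi (x : R) : y0 / phi y0 <= x ->
  is_derive x 1 psi (phi (psi x) ^+ 2 / (phi (psi x) - psi x * phi_ 1 (psi x))).
Proof.
move=> x0; have [yx E] := psi_spec x0; set y := psi x in yx E *.
have yp := lt_le_trans y0_gt0 yx.
have p0 := laplace_exponent_gt0 hnu yp.
have h0 := laplace_exponent_sub_moment_gt0 hnu yp.
rewrite -[X in is_derive X]E -[X in is_derive _ _ _ X]invf_div.
apply: (@is_derive_inverse R (fun y => y / phi y) psi _ y).
- by near=> z; apply: psi_ratio; near: z; exact: lt_nbhsr.
- near=> z; apply: is_derive_continuous; apply: is_derive_ratio.
  by near: z; exact: lt_nbhsr.
- exact: is_derive_ratio.
- by rewrite lt0r_neq0// divr_gt0// exprn_gt0.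
Unshelve. all: end_near. Qed.

End inverse.

(** * Taylor estimate for the exponential *)

(* [L] stands for the main part of [D - y v]. *)
Definition exp_error (R : realType) (y v D L : R) : R :=
  1 - expR (- D) - (1 - expR (- (y * v))) - expR (- (y * v)) * L.

Section pointwise_error.
Context (R : realType).
Implicit Types y v D a n r C c B : R.

Local Notation err := (@exp_error R).

(** Separates the quadratic remainder of [e^-T], where [T = D - y v], from the cost of replacing [T]
    by [L]. *)
Lemma exp_error_split y v D L : err y v D L =
  expR (- (y * v)) *
    (- (expR (- (D - y * v)) - 1 + (D - y * v)) + ((D - y * v) - L)).
Proof.
rewrite /exp_error; have -> : expR (- D) = expR (- (y * v)) * expR (- (D - y * v)).
  by rewrite -expRD; congr expR; ring.
by ring.
Qed.

(** The hypothesis [|C r| <= 1] keeps [C] out of the bound. [T] is of order [v + y v^2], so [T^2] is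
    controlled by [v^2 + y^2 v^4]; together with [y v^3 + v^2] every term is [y^-2] times a power of
    [y v]. *)
Lemma exp_error_small y v D a n r C c B :
  2 <= y -> 0 < v <= 1 -> 1 <= c -> 0 <= B ->
  0 <= a <= c * y -> 0 <= n <= c -> `|C * r| <= 1 -> v * (y - 1) <= D ->
  `|D - v * y - v ^+ 2 / 2 * a - v * n - C * v * r|
    <= B * (y * v ^+ 3 + v ^+ 2) ->
  `|err y v D (v * n + C * v * r + v ^+ 2 / 2 * a)|
  <= (52 * expR 1 * (B + 2 * c) ^+ 2 + 8 * B) / y ^+ 2
     * (1 - expR (- (y * v))).
Proof.
move=> y2 /andP[v0 v1] c1 B0 /andP[a0 ac] /andP[n0 nc] Cr vD HD.
rewrite exp_error_split; set T := D - y * v.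
set L := v * n + C * v * r + v ^+ 2 / 2 * a; set G := B + 2 * c.
have T1 : - v <= T by rewrite /T; nra.
have HT : `|T - L| <= B * (y * v ^+ 3 + v ^+ 2).
  by rewrite (_ : T - L = D - v * y - v ^+ 2 / 2 * a - v * n - C * v * r)// /T /L; ring.
have E1 := expRN_taylor (ltW v0) T1.
have ev : expR v <= expR 1 by rewrite ler_expR.
have v32 : v ^+ 3 <= v ^+ 2 by rewrite exprSr ler_piMr// sqr_ge0.
have v21 : v ^+ 2 <= v by rewrite expr2 ler_piMr// ltW.
have v20 : 0 <= v ^+ 2 by rewrite sqr_ge0.
have v30 : 0 <= v ^+ 3 by rewrite exprn_ge0// ltW.
have L1 : `|L| <= 2 * c * (v + y * v ^+ 2).
  have h1 : 0 <= v * n <= v * c by rewrite mulr_ge0 ?ler_wpM2l// ltW.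
  have h2 : `|C * v * r| <= v.
    rewrite (_ : C * v * r = v * (C * r)); last by ring.
    by rewrite normrM (gtr0_norm v0) ler_piMr// ltW.
  have h3 : 0 <= v ^+ 2 / 2 * a <= v ^+ 2 / 2 * (c * y).
    by rewrite mulr_ge0 ?ler_wpM2l ?divr_ge0.
  have h4 : v <= c * v by rewrite ler_peMl// ltW.
  have h5 : 0 <= c * y * v ^+ 2 by rewrite !mulr_ge0//; lra.
  move: h2; rewrite !ler_norml /L => /andP[h2 h2']; apply/andP; split; lra.
have G0 : 0 <= G by rewrite /G; lra.
have T2 : `|T| <= G * (v + y * v ^+ 2).
  have -> : T = (T - L) + L by rewrite subrK.
  apply: le_trans (ler_normD _ _) _.
  have : B * (y * v ^+ 3 + v ^+ 2) <= B * (v + y * v ^+ 2).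
    by rewrite ler_wpM2l//; nra.
  by rewrite /G; lra.
have T3 : T ^+ 2 <= 2 * G ^+ 2 * (v ^+ 2 + y ^+ 2 * v ^+ 4).
  rewrite -real_normK ?num_real//.
  apply: (@le_trans _ _ ((G * (v + y * v ^+ 2)) ^+ 2)).
    by rewrite lerXn2r// nnegrE// mulr_ge0// addr_ge0 ?(ltW v0)// mulr_ge0//; lra.
  have -> : 2 * G ^+ 2 * (v ^+ 2 + y ^+ 2 * v ^+ 4) =
    (G * (v + y * v ^+ 2)) ^+ 2 + (G * (v - y * v ^+ 2)) ^+ 2 by ring.
  by rewrite lerDl sqr_ge0.
have e1 := expR_gt0 (1 : R); have ey := expR_gt0 (- (y * v)).
rewrite normrM (gtr0_norm ey).
have E2 : `|- (expR (- T) - 1 + T) + (T - L)| <=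
    2 * expR 1 * G ^+ 2 * (v ^+ 2 + y ^+ 2 * v ^+ 4) + B * (y * v ^+ 3 + v ^+ 2).
  apply: le_trans (ler_normD _ _) _; rewrite normrN lerD//.
  apply: le_trans E1 _; apply: (@le_trans _ _ (expR 1 * T ^+ 2)).
    by rewrite ler_wpM2r// sqr_ge0.
  have -> : 2 * expR 1 * G ^+ 2 * (v ^+ 2 + y ^+ 2 * v ^+ 4) =
    expR 1 * (2 * G ^+ 2 * (v ^+ 2 + y ^+ 2 * v ^+ 4)) by ring.
  by rewrite ler_wpM2l// ltW.
apply: (le_trans (ler_wpM2l (ltW ey) E2)).
have yv0 : 0 <= y * v by rewrite mulr_ge0//; lra.
have t2 := exprM_expRN_le 1 yv0; have t3 := exprM_expRN_le 2 yv0.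
have t4 := exprM_expRN_le 3 yv0.
rewrite [leRHS]mulrAC ler_pdivlMr ?exprn_gt0//; last lra.
move: t2 t3 t4; set E := expR _; set W := 1 - E => t2 t3 t4.
(* Each [(y v)^j E] costs [j! W], whence [52 = 2 (2! + 4!)] and [8 = 3! + 2!]. *)
have -> : E * (2 * expR 1 * G ^+ 2 * (v ^+ 2 + y ^+ 2 * v ^+ 4) +
    B * (y * v ^+ 3 + v ^+ 2)) * y ^+ 2 =
  2 * expR 1 * G ^+ 2 * ((y * v) ^+ 2 * E + (y * v) ^+ 4 * E) +
    B * ((y * v) ^+ 3 * E + (y * v) ^+ 2 * E) by ring.
have -> : (52 * expR 1 * G ^+ 2 + 8 * B) * W =
  2 * expR 1 * G ^+ 2 * ((2`!)%:R * W + (4`!)%:R * W) +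
    B * ((3`!)%:R * W + (2`!)%:R * W) by rewrite !factS fact0 /=; ring.
have g0 : 0 <= 2 * expR 1 * G ^+ 2 by rewrite !mulr_ge0 ?sqr_ge0// ltW.
by apply: lerD; apply: ler_wpM2l => //; apply: lerD.
Qed.

(** Away from zero no cancellation is used: with [t = y v], the terms [e^-t], [e^-D] and [e^-t L]
    are separately [O(1 / t^2)], because [y >= 2] gives [D >= v (y - 1) >= t / 2]; and [t >= y]. *)
Lemma exp_error_large y v D a n r C c :
  2 <= y -> 1 <= v -> 1 <= c ->
  0 <= a <= c * y -> 0 <= n <= c -> `|C * r| <= 1 -> v * (y - 1) <= D ->
  `|err y v D (v * n + C * v * r + v ^+ 2 / 2 * a)|
  <= 92 * c / y ^+ 2 * (1 - expR (- (y * v))).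
Proof.
move=> y2 v1 c1 /andP[a0 ac] /andP[n0 nc] Cr vD.
set L := v * n + C * v * r + v ^+ 2 / 2 * a; set t := y * v.
have yt : y <= t by rewrite /t ler_peMr//; lra.
have t0 : 0 < t by lra.
have vt : v <= t by rewrite /t ler_peMl//; lra.
have v0 : 0 <= v by lra.
have v20 : 0 <= v ^+ 2 by rewrite sqr_ge0.
have v2t : y * v ^+ 2 <= t ^+ 2.
  by rewrite /t exprMn ler_wpM2r// expr2 ler_peMr//; lra.
have L1 : `|L| <= 2 * c * t + c * t ^+ 2.
  have h1 : 0 <= v * n <= v * c by rewrite mulr_ge0 ?ler_wpM2l.
  have h2 : `|C * v * r| <= v.
    rewrite (_ : C * v * r = v * (C * r)); last by ring.
    by rewrite normrM (ger0_norm v0) ler_piMr.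
  have h3 : 0 <= v ^+ 2 / 2 * a <= v ^+ 2 / 2 * (c * y).
    by rewrite mulr_ge0 ?ler_wpM2l ?divr_ge0.
  have h4 : v <= c * v by rewrite ler_peMl.
  have h5 : c * v <= c * t by rewrite ler_wpM2l//; lra.
  have h6 : c * (y * v ^+ 2) <= c * t ^+ 2 by rewrite ler_wpM2l//; lra.
  have h7 : 0 <= c * (y * v ^+ 2) by rewrite !mulr_ge0//; lra.
  by move: h2; rewrite !ler_norml /L => /andP[h2 h2']; apply/andP; split; lra.
have eD : expR (- D) <= expR (- (t / 2)).
  by rewrite ler_expR lerN2 (le_trans _ vD)// /t; nra.
have eD0 := expR_gt0 (- D).
have h2 := exprM_expRN_le 1 (divr_ge0 (ltW t0) (ler0n R 2)).
have h2' := expR_ge0 (- (t / 2)).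
have eD2 : t ^+ 2 * expR (- D) <= 8.
  apply: (le_trans (ler_wpM2l (sqr_ge0 t) eD)).
  rewrite (_ : t ^+ 2 * _ = 4 * ((t / 2) ^+ 2 * expR (- (t / 2)))); last by field.
  by move: h2; rewrite !factS fact0 /=; set X := (_ ^+ _ * _); lra.
set E := expR (- t); have E0 : 0 <= E by exact: expR_ge0.
have k2 := exprM_expRN_le 1 (ltW t0); have k3 := exprM_expRN_le 2 (ltW t0).
have k4 := exprM_expRN_le 3 (ltW t0).
have E2 : t ^+ 2 * E <= 2 by move: k2; rewrite -/E !factS fact0 /=; lra.
have E3 : t ^+ 3 * E <= 6 by move: k3; rewrite -/E !factS fact0 /=; lra.
have E4 : t ^+ 4 * E <= 24 by move: k4; rewrite -/E !factS fact0 /=; lra.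
have E12 : E <= 1 / 2.
  have : E * (1 + t) <= 1.
    apply: (@le_trans _ _ (E * expR t)); first by rewrite ler_wpM2l// expR_ge1Dx.
    by rewrite /E -expRD addNr expR0.
  nra.
have -> : err y v D L = E - expR (- D) - E * L by rewrite /exp_error /E /t; ring.
(* The four terms add up to at most [2 + 8 + 12 c + 24 c <= 46 c]. Since [1 - E >= 1 / 2], this
   becomes [92 c] in front of the weight. *)
have X1 : t ^+ 2 * `|E - expR (- D) - E * L| <= 46 * c.
  apply: (@le_trans _ _ (t ^+ 2 * (E + expR (- D) + E * (2 * c * t + c * t ^+ 2)))).
    rewrite ler_wpM2l ?sqr_ge0//.
    apply: le_trans (ler_normB _ _) _; rewrite lerD//.
      by apply: le_trans (ler_normB _ _) _; rewrite !ger0_norm// ltW.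
    by rewrite normrM (ger0_norm E0) ler_wpM2l.
  have -> : t ^+ 2 * (E + expR (- D) + E * (2 * c * t + c * t ^+ 2)) =
    t ^+ 2 * E + t ^+ 2 * expR (- D) + 2 * c * (t ^+ 3 * E) + c * (t ^+ 4 * E).
    by ring.
  have c0 : 0 <= c by lra.
  have := ler_wpM2l c0 E3; have := ler_wpM2l c0 E4; lra.
rewrite [leRHS]mulrAC ler_pdivlMr ?exprn_gt0//; last lra.
have yt2 : y ^+ 2 <= t ^+ 2 by rewrite lerXn2r// nnegrE; lra.
apply: (@le_trans _ _ (46 * c)).
  by apply: le_trans X1; rewrite mulrC ler_wpM2r.
have : c * (1 / 2) <= c * (1 - E) by rewrite ler_wpM2l//; lra.
by lra.
Qed.

End pointwise_error.

(** The variable is [u = ln x]. The record isolates what the error analysis needs from [psi]: [S],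
    [M] and [- 1 / s] are primitives of [s], [n] and [r], and one constant [c] controls all
    sizes. *)
Record regular_phase (R : realType) (S s a b M n n1 r r1 : R -> R) (u0 c : R)
    : Prop := RegularPhase {
  phase_c : 1 <= c ;
  phase_ge2 : forall u, u0 <= u -> 2 <= s u ;
  phase_dS : forall u, u0 <= u -> is_derive u 1 S (s u) ;
  phase_ds : forall u, u0 <= u -> is_derive u 1 s (a u) ;
  phase_da : forall u, u0 <= u -> is_derive u 1 a (b u) ;
  phase_dM : forall u, u0 <= u -> is_derive u 1 M (n u) ;
  phase_dn : forall u, u0 <= u -> is_derive u 1 n (n1 u) ;
  phase_dV : forall u, u0 <= u -> is_derive u 1 (fun u => (s u)^-1) (- r u) ;
  phase_dr : forall u, u0 <= u -> is_derive u 1 r (r1 u) ;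
  phase_a : forall u, u0 <= u -> 0 <= a u <= c * s u ;
  phase_b : forall u, u0 <= u -> `|b u| <= c * s u ;
  phase_n : forall u, u0 <= u -> 0 <= n u <= c ;
  phase_n1 : forall u, u0 <= u -> `|n1 u| <= c ;
  phase_r : forall u, u0 <= u -> `|r u| <= c / s u ;
  phase_r1 : forall u, u0 <= u -> `|r1 u| <= c / s u }.

(** The sum of the constants of [exp_error_small], taken with the Taylor constant of
    [phase_fun_taylor], and of [exp_error_large]; it is free of [C]. *)
Definition phase_error_bound (R : realType) (c : R) : R :=
  52 * expR 1 * ((c * expR c + c + 1) + 2 * c) ^+ 2
  + 8 * (c * expR c + c + 1) + 92 * c.

(** * Increments of a regular phase *)

Section phase.
Context (R : realType) (S s a b M n n1 r r1 : R -> R) (u0 c : R).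
Hypothesis H : regular_phase S s a b M n n1 r r1 u0 c.
Context (C : R).

Definition phase_fun (u : R) : R := S u + M u - C / s u.
Local Notation g := phase_fun.

Lemma is_derive_phase_fun (u : R) :
  u0 <= u -> is_derive u 1 g (s u + n u + C * r u).
Proof.
move=> uu; have := phase_dS H uu => ?; have := phase_dM H uu => ?.
have := phase_dV H uu => ?.
by apply: is_derive_eq; rewrite /GRing.scale/=; ring.
Qed.

Lemma phase_nondecreasing (u w : R) : u0 <= u -> u <= w -> s u <= s w.
Proof.
move=> uu uw; apply: (derive_ge0_le uw (df := a)) => x /andP[ux _].
  exact: phase_ds H _ (le_trans uu ux).
by have /andP[] := phase_a H (le_trans uu ux).
Qed.

(** Gronwall: [a <= c s] makes [s x * e^(- c x)] nonincreasing. This is the origin of [expR c] in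
    [phase_error_bound]. *)
Lemma phase_growth (u w : R) : u0 <= u -> u <= w <= u + 1 ->
  s w <= s u * expR c.
Proof.
move=> uu /andP[uw wu].
have c1 := phase_c H.
have h : s w * expR (c * (u - w)) <= s u * expR (c * (u - u)).
  rewrite -lerN2.
  apply: (@derive_ge0_le R (fun x => - (s x * expR (c * (u - x))))
    (fun x => (c * s x - a x) * expR (c * (u - x)))) => // x /andP[ux _].
    have := phase_ds H (le_trans uu ux) => ?.
    by apply: is_derive_eq; rewrite /GRing.scale/=; ring.
  have /andP[_ ?] := phase_a H (le_trans uu ux).
  by rewrite mulr_ge0 ?expR_ge0// subr_ge0.
rewrite subrr mulr0 expR0 mulr1 in h.
have s2 := phase_ge2 H (le_trans uu uw).
have E : expR (c * (u - w)) * expR (c * (w - u)) = 1.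
  by rewrite -expRD -mulrDr (_ : u - w + (w - u) = 0) ?mulr0 ?expR0//; ring.
apply: (@le_trans _ _ (s u * expR (c * (w - u)))).
  rewrite -[leLHS]mulr1 -E mulrA ler_wpM2r ?expR_ge0//.
rewrite ler_wpM2l//; first by have := phase_ge2 H uu; lra.
by rewrite ler_expR ler_piMr//; lra.
Qed.

(** Here [C] is neutralised: past the threshold [|C| c <= s u] its term changes the slope by at most
    1. *)
Lemma phase_correction (u w : R) : u0 <= u -> u <= w -> `|C| * c <= s u ->
  `|C * r w| <= 1.
Proof.
move=> uu uw Cs; rewrite normrM.
have := phase_r H (le_trans uu uw); have s2 := phase_ge2 H uu.
have sw := phase_nondecreasing uu uw => rw.
apply: (le_trans (ler_wpM2l (normr_ge0 C) rw)).
by rewrite mulrA ler_pdivrMr ?mul1r; lra.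
Qed.

Lemma phase_slope (u w : R) : u0 <= u -> u <= w -> `|C| * c <= s u ->
  s u - 1 <= s w + n w + C * r w.
Proof.
move=> uu uw Cs; have := phase_correction uu uw Cs.
have sw := phase_nondecreasing uu uw.
have /andP[nw _] := phase_n H (le_trans uu uw).
by rewrite ler_norml => /andP[Cr _]; lra.
Qed.

Lemma phase_increment (u v : R) : u0 <= u -> 0 <= v -> `|C| * c <= s u ->
  v * (s u - 1) <= g (u + v) - g u.
Proof.
move=> uu v0 Cs; have uv : u <= u + v by rewrite lerDl.
have dg x : u <= x <= u + v -> is_derive x 1 g (s x + n x + C * r x).
  by move=> /andP[ux _]; exact: is_derive_phase_fun (le_trans uu ux).
have [w /andP[uw _] ->] := MVT_closed uv dg.
rewrite (_ : u + v - u = v); last by ring.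
rewrite mulrC ler_wpM2r//.
exact: phase_slope.
Qed.

(** [S] is expanded to second order, [M] and [1 / s] only to first, as their second derivatives are
    already bounded. The factor [1 / s] in the bound on [r1] absorbs [|C|]. *)
Lemma phase_fun_taylor (u v : R) : u0 <= u -> 0 <= v <= 1 ->
  `|C| * c <= s u ->
  `|g (u + v) - g u - v * s u - v ^+ 2 / 2 * a u - v * n u - C * v * r u|
  <= (c * expR c + c + 1) * (s u * v ^+ 3 + v ^+ 2).
Proof.
move=> uu /andP[v0 v1] Cs; have c1 := phase_c H; have s2 := phase_ge2 H uu.
have hu x : u <= x <= u + v -> u0 <= x by move=> /andP[/(le_trans uu)].
have h1 := @taylor2_bound R S s a b u v (c * (s u * expR c)) v0
  (fun x h => phase_dS H (hu x h)) (fun x h => phase_ds H (hu x h))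
  (fun x h => phase_da H (hu x h)).
have h2 := @taylor1_bound R M n n1 u v c v0
  (fun x h => phase_dM H (hu x h)) (fun x h => phase_dn H (hu x h))
  (fun x h => phase_n1 H (hu x h)).
have dr' x : u <= x <= u + v -> is_derive x 1 (fun x => - r x) (- r1 x).
  by move=> /hu /(phase_dr H) ?; exact: is_deriveN.
have h3 := @taylor1_bound R (fun x => (s x)^-1) (fun x => - r x)
  (fun x => - r1 x) u v (c / s u) v0 (fun x h => phase_dV H (hu x h)) dr'.
have {}h1 : `|S (u + v) - S u - v * s u - v ^+ 2 / 2 * a u|
    <= c * (s u * expR c) * v ^+ 3.
  apply: h1 => x xuv; apply: le_trans (phase_b H (hu _ xuv)) _.
  rewrite ler_wpM2l//; first lra.
  apply: phase_growth => //; move: xuv => /andP[-> /=] xuv.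
  by rewrite (le_trans xuv)// lerD2l.
have {}h3 : `|(s (u + v))^-1 - (s u)^-1 - v * - r u| <= c / s u * v ^+ 2.
  apply: h3 => x xuv; rewrite normrN; apply: le_trans (phase_r1 H (hu _ xuv)) _.
  have ss : s u <= s x by apply: phase_nondecreasing => //; case/andP: xuv.
  by rewrite ler_wpM2l ?lef_pV2 ?posrE//; lra.
have {}h3 : `|C * ((s (u + v))^-1 - (s u)^-1 - v * - r u)| <= v ^+ 2.
  rewrite normrM; apply: (le_trans (ler_wpM2l (normr_ge0 C) h3)).
  rewrite (_ : `|C| * _ = (`|C| * c / s u) * v ^+ 2); last by ring.
  apply: ler_piMl; first exact: sqr_ge0.
  by rewrite ler_pdivrMr ?mul1r//; lra.
have -> : g (u + v) - g u - v * s u - v ^+ 2 / 2 * a u - v * n u - C * v * r u =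
  (S (u + v) - S u - v * s u - v ^+ 2 / 2 * a u) + (M (u + v) - M u - v * n u)
  - C * ((s (u + v))^-1 - (s u)^-1 - v * - r u) by rewrite /phase_fun; ring.
apply: le_trans (ler_normB _ _) _.
apply: le_trans (lerD (le_trans (ler_normD _ _) (lerD h1 h2)) h3) _.
have -> : c * (s u * expR c) * v ^+ 3 + c * v ^+ 2 + v ^+ 2 =
  c * expR c * (s u * v ^+ 3) + (c + 1) * v ^+ 2 by ring.
have p1 : 0 <= s u * v ^+ 3 by rewrite mulr_ge0 ?exprn_ge0//; lra.
have p2 : 0 <= v ^+ 2 by rewrite sqr_ge0.
have p3 : 0 <= c * expR c by rewrite mulr_ge0 ?expR_ge0//; lra.
have q1 : 0 <= (c + 1) * (s u * v ^+ 3) by rewrite mulr_ge0//; lra.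
have q2 : 0 <= c * expR c * v ^+ 2 by rewrite mulr_ge0.
by move: q1 q2; set X := s u * _; set E := c * expR c; lra.
Qed.

Lemma phase_exp_error (u v : R) : u0 <= u -> 0 < v -> `|C| * c <= s u ->
  `|exp_error (s u) v (g (u + v) - g u)
      (v * n u + C * v * r u + v ^+ 2 / 2 * a u)|
  <= phase_error_bound c / s u ^+ 2 * (1 - expR (- (s u * v))).
Proof.
move=> uu v0 Cs; have c1 := phase_c H; have s2 := phase_ge2 H uu.
have Cr := phase_correction uu (lexx u) Cs.
have inc := phase_increment uu (ltW v0) Cs.
have E0 := expR_ge0 c.
have B0 : 0 <= c * expR c + c + 1.
  by rewrite !addr_ge0 ?mulr_ge0//; lra.
have W0 : 0 <= 1 - expR (- (s u * v)).
  by rewrite subr_ge0 -expR0 ler_expR oppr_le0 mulr_ge0//; lra.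
have e10 := expR_ge0 (1 : R).
have is0 : 0 <= (s u ^+ 2)^-1 by rewrite invr_ge0 sqr_ge0.
have [v1|v1] := leP v 1.
  have v01 : 0 < v <= 1 by rewrite v0.
  have v01' : 0 <= v <= 1 by rewrite ltW.
  apply: le_trans (exp_error_small s2 v01 c1 B0 (phase_a H uu) (phase_n H uu)
    Cr inc (phase_fun_taylor uu v01' Cs)) _.
  do 2 (rewrite ler_wpM2r//); rewrite /phase_error_bound lerDl mulr_ge0//; lra.
apply: le_trans (exp_error_large s2 (ltW v1) c1 (phase_a H uu) (phase_n H uu)
  Cr inc) _.
do 2 (rewrite ler_wpM2r//); rewrite /phase_error_bound lerDr.
apply: addr_ge0; last by rewrite mulr_ge0.
by apply: mulr_ge0; [exact: mulr_ge0|exact: sqr_ge0].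
Qed.

(** Unit growth of [g] in [u] makes [e^-g] decay at least like [1 / x], as the comparison at
    infinity requires. *)
Lemma phase_fun_ge (u w : R) : u0 <= u -> u <= w -> `|C| * c <= s u ->
  g u + (w - u) <= g w.
Proof.
move=> uu uw Cs; have wu0 : 0 <= w - u by rewrite subr_ge0.
have := phase_increment uu wu0 Cs; have s2 := phase_ge2 H uu.
rewrite (addrC u) subrK.
have : (w - u) * 1 <= (w - u) * (s u - 1) by rewrite ler_wpM2l//; lra.
by lra.
Qed.

End phase.

(** * The phase attached to psi *)

Section laplace_phase.
Context (R : realType) (nu : {measure set R -> \bar R}).
Hypothesis hnu : levy_measure nu.

Local Notation phi := (laplace_exponent nu).
Local Notation phi_ := (laplace_moment nu).
Local Notation psi := (psi_of phi).

#[local] Opaque laplace_exponent laplace_moment.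

(* [amp] is [1 / (1 - y phi'(y) / phi(y))] and [vel] is the speed [ds/du] of
   [s(u) = psi(e^u)] at [s = y]. *)
Definition eta (y : R) : R := phi y - y * phi_ 1 y.
Definition amp (y : R) : R := phi y / eta y.
Definition amp1 (y : R) : R := phi_ 1 y / eta y - phi y * (y * phi_ 2 y) / eta y ^+ 2.
Definition vel (y : R) : R := y * amp y.
Definition vel1 (y : R) : R := amp y + y * amp1 y.
Definition second_order (y : R) : R := vel y ^+ 2 * phi_ 2 y / (2 * phi y).
Definition second_order1 (y : R) : R := vel y * vel1 y * phi_ 2 y / phi y
  - vel y ^+ 2 * phi_ 3 y / (2 * phi y)
  - vel y ^+ 2 * phi_ 2 y * phi_ 1 y / (2 * phi y ^+ 2).
(** This is [vel y / y^2]; at [y = psi x] it is [x] times the error term of the theorem. *)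
Definition rate (y : R) : R := amp y / y.
Definition rate1 (y : R) : R := amp1 y / y - amp y / y ^+ 2.

Section at_point.
Context (y : R).
Hypothesis yp : 0 < y.

Lemma eta_gt0 : 0 < eta y.
Proof. exact: laplace_exponent_sub_moment_gt0. Qed.

Let p0 : 0 < phi y := laplace_exponent_gt0 hnu yp.

Lemma is_derive_eta : is_derive y 1 eta (y * phi_ 2 y).
Proof.
have := is_derive_laplace_exponent hnu yp => ?.
have := is_derive_laplace_moment hnu 0 yp => ?.
by apply: is_derive_eq; rewrite /GRing.scale/=; ring.
Qed.

Lemma is_derive_amp : is_derive y 1 amp (amp1 y).
Proof.
have d1 := is_derive_laplace_exponent hnu yp.
have e0 := lt0r_neq0 eta_gt0.
apply: (is_derive_eq (is_derive_div e0 d1 is_derive_eta)).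
by rewrite /amp1; field.
Qed.

Lemma is_derive_vel : is_derive y 1 vel (vel1 y).
Proof.
have := is_derive_amp => ?.
by apply: is_derive_eq; rewrite /GRing.scale/= /vel1; ring.
Qed.

Lemma is_derive_second_order : is_derive y 1 second_order (second_order1 y).
Proof.
have d1 := is_derive_laplace_exponent hnu yp.
have d2 := is_derive_laplace_moment hnu 1 yp.
have dv := is_derive_vel.
have q0 : 2 * phi y != 0 by rewrite lt0r_neq0// mulr_gt0.
have n1 : is_derive y 1 (fun y => vel y ^+ 2 * phi_ 2 y)
    (2 * vel y * vel1 y * phi_ 2 y - vel y ^+ 2 * phi_ 3 y).
  by apply: is_derive_eq; rewrite /GRing.scale/=; ring.
have n2 : is_derive y 1 (fun y => 2 * phi y) (2 * phi_ 1 y).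
  by apply: is_derive_eq; rewrite /GRing.scale/=; ring.
apply: (is_derive_eq (@is_derive_div R _ (fun y => 2 * phi y) y _ _ q0 n1 n2)).
by rewrite /second_order1; field; rewrite lt0r_neq0.
Qed.

Lemma is_derive_rate : is_derive y 1 rate (rate1 y).
Proof.
apply: (is_derive_eq (@is_derive_div R _ id y _ _ (lt0r_neq0 yp) is_derive_amp
  (@is_derive_id _ _ y 1))).
by rewrite /rate1; field; rewrite lt0r_neq0.
Qed.

(** With [second_orderE] this shows that [ln (eta (s u)) / 2] is a primitive of the second-order
    correction in [u]. *)
Lemma is_derive_half_ln_eta :
  is_derive y 1 (fun y => ln (eta y) / 2) (y * phi_ 2 y / (2 * eta y)).
Proof.
have dl := is_derive1_ln eta_gt0.
have := @is_derive1_comp _ (@ln R) eta y _ _ dl is_derive_eta => dd.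
have dd' : is_derive y 1 (fun y => ln (eta y)) ((eta y)^-1 * (y * phi_ 2 y)) by exact: dd.
have e0 := lt0r_neq0 eta_gt0.
by apply: is_derive_eq; rewrite /GRing.scale/=; field.
Qed.

Lemma second_orderE : y * phi_ 2 y / (2 * eta y) * vel y = second_order y.
Proof.
by rewrite /second_order /vel /amp; field; rewrite !lt0r_neq0// eta_gt0.
Qed.

Context (e : R).
Hypothesis e01 : 0 < e <= 1.
Hypothesis eta_ge : e * phi y <= eta y.

Let q : R := e^-1.

(** Everything is a polynomial in [h = amp y], which lies in [[1, 1 / e]], and in the scale-free
    ratios [y^j phi_j / phi], which [moment_le] places in [[0, j!]]. The only surviving power of [y]
    is the [1 / y] in the last bound. *)
Lemma phase_bounds : [/\ 1 <= amp y <= q,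
  0 <= second_order y <= q ^+ 2,
  `|vel1 y| <= 4 * q ^+ 2,
  `|second_order1 y * vel y| <= 12 * q ^+ 4 &
  `|rate1 y * vel y| <= 4 * q ^+ 3 / y].
Proof.
have /andP[e0 e1] := e01; have ep0 := eta_gt0; have P := p0.
have q0 : 0 < q by rewrite invr_gt0.
have q1 : 1 <= q by rewrite -invr1 lef_pV2 ?posrE.
have m1 := moment_le hnu 0 yp; have m2 := moment_le hnu 1 yp.
have m3 := moment_le hnu 2 yp.
have g1 := moment_ge0 nu 1 y; have g2 := moment_ge0 nu 2 y.
have g3 := moment_ge0 nu 3 y.
pose r1 := y * phi_ 1 y / phi y; pose r2 := y ^+ 2 * phi_ 2 y / phi y.
pose r3 := y ^+ 3 * phi_ 3 y / phi y; pose h := amp y.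
have yn0 := lt0r_neq0 yp; have Pn0 := lt0r_neq0 P; have epn0 := lt0r_neq0 ep0.
have yge0 := ltW yp.
have r1b : 0 <= r1 <= 1.
  rewrite divr_ge0 ?mulr_ge0 ?(ltW P)//= ler_pdivrMr//.
have r2b : 0 <= r2 <= 2.
  by rewrite divr_ge0 ?mulr_ge0 ?exprn_ge0 ?(ltW P)//= ler_pdivrMr.
have r3b : 0 <= r3 <= 6.
  by rewrite divr_ge0 ?mulr_ge0 ?exprn_ge0 ?(ltW P)//= ler_pdivrMr.
have h1 : 1 <= h.
  rewrite /h /amp ler_pdivlMr// mul1r /eta gerBl mulr_ge0//.
have hq : h <= q.
  by rewrite /h /amp /q ler_pdivrMr// mulrC ler_pdivlMr// mulrC.
have h0 : 0 <= h by lra.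
have p2 : h ^+ 2 <= q ^+ 2 by rewrite lerXn2r// nnegrE ltW.
have p3 : h ^+ 3 <= q ^+ 3 by rewrite lerXn2r// nnegrE ltW.
have q12 : q <= q ^+ 2 by rewrite expr2 ler_peMl// ltW.
have q23 : q ^+ 2 <= q ^+ 3 by rewrite [leRHS]exprS ler_peMl// exprn_ge0// ltW.
have q34 : q ^+ 3 <= q ^+ 4 by rewrite [leRHS]exprS ler_peMl// exprn_ge0// ltW.
have hr1 : 0 <= h * r1 <= q.
  case/andP: r1b => ? ?; rewrite mulr_ge0//= -[leRHS]mulr1 ler_pM//.
have h2r2 : 0 <= h ^+ 2 * r2 <= 2 * q ^+ 2.
  case/andP: r2b => ? ?; rewrite mulr_ge0 ?exprn_ge0//= mulrC ler_pM ?exprn_ge0//.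
have v1E : vel1 y = h + h * r1 - h ^+ 2 * r2.
  by rewrite /vel1 /amp1 /h /amp /r1 /r2; field; rewrite Pn0.
have v1b : `|vel1 y| <= 4 * q ^+ 2.
  by rewrite v1E ler_norml; apply/andP; split; lra.
split.
- by rewrite -/h h1.
- have -> : second_order y = h ^+ 2 * r2 / 2.
    by rewrite /second_order /vel -/h /r2; field; rewrite Pn0.
  by apply/andP; split; lra.
- by [].
- have -> : second_order1 y * vel y =
      h ^+ 2 * r2 * vel1 y - h ^+ 3 * r3 / 2 - h ^+ 2 * r2 * (h * r1) / 2.
    rewrite /second_order1 /vel -/h /r1 /r2 /r3; set V := vel1 y.
    by field; rewrite Pn0.
  have h3r3 : 0 <= h ^+ 3 * r3 <= 6 * q ^+ 3.
    by case/andP: r3b => ? ?; rewrite mulr_ge0 ?exprn_ge0//= mulrC ler_pM ?exprn_ge0.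
  have t1 : `|h ^+ 2 * r2 * vel1 y| <= 8 * q ^+ 4.
    case/andP: h2r2 => a1 a2.
    have -> : 8 * q ^+ 4 = (2 * q ^+ 2) * (4 * q ^+ 2) by ring.
    rewrite normrM (ger0_norm a1); apply: ler_pM => //.
  have t2 : 0 <= h ^+ 2 * r2 * (h * r1) <= 2 * q ^+ 3.
    case/andP: h2r2 => a1 a2; case/andP: hr1 => b1 b2.
    have -> : 2 * q ^+ 3 = (2 * q ^+ 2) * q by ring.
    by rewrite mulr_ge0//= ler_pM.
  move: t1; rewrite !ler_norml => /andP[t1 t1'].
  by apply/andP; split; lra.
- have -> : rate1 y * vel y = (h * r1 - h ^+ 2 * r2 - h) * h / y.
    by rewrite /rate1 /amp1 /vel /h /amp /r1 /r2; field; rewrite yn0 epn0.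
  rewrite normrM (gtr0_norm (_ : 0 < y^-1)) ?invr_gt0//.
  rewrite ler_wpM2r ?invr_ge0// normrM (ger0_norm h0).
  have -> : 4 * q ^+ 3 = (4 * q ^+ 2) * q by ring.
  by rewrite ler_pM// ler_norml; apply/andP; split; lra.
Qed.

End at_point.

Lemma continuous_inv_amp (y : R) : 0 < y -> {for y, continuous (fun y => (amp y)^-1)}.
Proof.
move=> yp; have h0 : amp y != 0.
  by rewrite lt0r_neq0// divr_gt0 ?eta_gt0// laplace_exponent_gt0.
exact: is_derive_continuous (is_deriveV h0 (is_derive_amp yp)).
Qed.

(* Since [ds/du = s amp(s)], composing this function with [s] gives a primitive
   of [s] in [u]. *)
Definition inv_amp_primitive (y : R) : R :=
  \int[lebesgue_measure]_(t in `[1, y]) (amp t)^-1.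

Lemma is_derive_inv_amp_primitive (y : R) : 1 < y ->
  is_derive y 1 inv_amp_primitive (amp y)^-1.
Proof.
move=> y1; have yy1 : y < y + 1 by rewrite ltrDl.
have int1 : lebesgue_measure.-integrable `[1, y + 1]
    (EFin \o (fun t => (amp t)^-1)).
  apply: continuous_compact_integrable; first exact: segment_compact.
  apply: continuous_in_subspaceT => x; rewrite inE /= in_itv /= => /andP[x1 _].
  by apply: continuous_inv_amp; exact: lt_le_trans x1.
have cy : {for y, continuous (fun t => (amp t)^-1)}.
  by apply: continuous_inv_amp; exact: lt_trans y1.
have [d1 d2] := continuous_FTC1_closed yy1 int1 y1 cy.
by split; [exact: d1|rewrite -derive1E -d2].
Qed.

Section asymptotic.
Context (e y0 : R).
Hypothesis e01 : 0 < e <= 1.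
Hypothesis y02 : 2 <= y0.
Hypothesis eta_ge : forall y, y0 <= y -> e * phi y <= phi y - y * phi_ 1 y.

Definition psi_exp (u : R) : R := psi (expR u).
Local Notation s := psi_exp.

Let ratio_le_expR (u : R) : ln (y0 / phi y0) <= u -> y0 / phi y0 <= expR u.
Proof.
have yp : 0 < y0 by exact: lt_le_trans y02.
have x0 := divr_gt0 yp (laplace_exponent_gt0 hnu yp).
by rewrite -ler_expR lnK ?posrE.
Qed.

Lemma psi_exp_spec (u : R) : ln (y0 / phi y0) <= u ->
  y0 <= s u /\ s u / phi (s u) = expR u.
Proof.
by move=> uu; apply: (psi_spec hnu e01 y02 eta_ge); exact: ratio_le_expR.
Qed.

Lemma is_derive_psi_exp (u : R) : ln (y0 / phi y0) <= u ->
  is_derive u 1 s (vel (s u)).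
Proof.
move=> uu; have [ys E] := psi_exp_spec uu.
have yp : 0 < y0 by exact: lt_le_trans y02.
have sp := lt_le_trans yp ys.
have d1 := is_derive_psi hnu e01 y02 eta_ge (ratio_le_expR uu).
apply: (is_derive_eq (is_derive1_comp d1 (is_derive_expR u))).
have := eta_gt0 sp; rewrite -[psi _]/(s u) -E /vel /amp /eta => h0.
by field; rewrite !lt0r_neq0// laplace_exponent_gt0.
Qed.

(** As [1 / e >= 1], the single constant [12 / e^4] dominates all the bounds drawn from
    [phase_bounds]. *)
Lemma laplace_regular_phase :
  regular_phase (fun u => inv_amp_primitive (s u)) s (fun u => vel (s u))
    (fun u => vel1 (s u) * vel (s u)) (fun u => ln (eta (s u)) / 2)
    (fun u => second_order (s u)) (fun u => second_order1 (s u) * vel (s u))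
    (fun u => rate (s u)) (fun u => rate1 (s u) * vel (s u))
    (ln (y0 / phi y0)) (12 * e^-1 ^+ 4).
Proof.
have /andP[e0 e1] := e01; have y02' := y02.
pose q := e^-1.
have q0 : 0 < q by rewrite invr_gt0.
have q1 : 1 <= q by rewrite -invr1 lef_pV2 ?posrE.
have q12 : q <= q ^+ 2 by rewrite expr2 ler_peMl// ltW.
have q23 : q ^+ 2 <= q ^+ 3 by rewrite [leRHS]exprS ler_peMl// exprn_ge0// ltW.
have q34 : q ^+ 3 <= q ^+ 4 by rewrite [leRHS]exprS ler_peMl// exprn_ge0// ltW.
rewrite -/q; set c := 12 * q ^+ 4.
have qc : q <= c by rewrite /c; lra.
have c0 : 0 <= c by lra.
have ge2 u : ln (y0 / phi y0) <= u -> 2 <= s u.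
  by move=> /psi_exp_spec[ys _]; exact: le_trans ys.
have sp u : ln (y0 / phi y0) <= u -> 0 < s u by move=> /ge2; exact: lt_le_trans.
have B u : ln (y0 / phi y0) <= u -> _ :=
  fun uu => phase_bounds (sp u uu) e01 (eta_ge (proj1 (psi_exp_spec uu))).
have ds := is_derive_psi_exp.
split.
- by lra.
- exact: ge2.
- move=> u uu; have s2 := ge2 _ uu; have s1 : 1 < s u by lra.
  apply: (is_derive_eq (is_derive1_comp (is_derive_inv_amp_primitive s1) (ds _ uu))).
  have [/andP[h1 _] _ _ _ _] := B _ uu.
  by rewrite /vel mulrC mulfK// lt0r_neq0//; lra.
- exact: ds.
- by move=> u uu; exact: is_derive1_comp (is_derive_vel (sp _ uu)) (ds _ uu).
- move=> u uu; rewrite -(second_orderE (sp _ uu)).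
  exact: (is_derive1_comp (is_derive_half_ln_eta (sp _ uu)) (ds _ uu)).
- by move=> u uu; exact: is_derive1_comp (is_derive_second_order (sp _ uu)) (ds _ uu).
- move=> u uu; have s0 := lt0r_neq0 (sp _ uu).
  apply: (is_derive_eq (is_deriveV s0 (ds _ uu))).
  by rewrite /GRing.scale/= /rate /vel; field.
- by move=> u uu; exact: is_derive1_comp (is_derive_rate (sp _ uu)) (ds _ uu).
- move=> u uu; have [/andP[h1 hq] _ _ _ _] := B _ uu; have s0 := ltW (sp _ uu).
  rewrite /vel mulr_ge0//=; last lra.
  by rewrite mulrC ler_wpM2r//; exact: le_trans qc.
- move=> u uu; have [/andP[h1 hq] _ v1 _ _] := B _ uu; have s0 := ltW (sp _ uu).
  have h0 : 0 <= amp (s u) by lra.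
  rewrite normrM /vel normrM (ger0_norm s0) (ger0_norm h0) mulrCA mulrC.
  rewrite ler_wpM2r//.
  apply: (@le_trans _ _ (4 * q ^+ 2 * q)); first by rewrite ler_pM.
  by rewrite -mulrA -exprSr /c; lra.
- by move=> u uu; have [_ /andP[-> /=] n2 _ _ _] := B _ uu; rewrite /c -/q in n2 *; lra.
- by move=> u uu; have [_ _ _ + _] := B _ uu.
- move=> u uu; have [/andP[h1 hq] _ _ _ _] := B _ uu; have s0 := sp _ uu.
  rewrite /rate ger0_norm; last by rewrite divr_ge0 ?(ltW s0)//; lra.
  by rewrite ler_wpM2r ?invr_ge0 ?(ltW s0)//; exact: le_trans qc.
- move=> u uu; have [_ _ _ _ r1] := B _ uu; have s0 := sp _ uu.
  apply: (le_trans r1); rewrite ler_wpM2r ?invr_ge0 ?(ltW s0)//.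
  by rewrite -/q /c; lra.
Qed.

End asymptotic.
End laplace_phase.

(** * The tail of the exponential functional *)

Lemma measurable_nat_glue d (T : measurableType d) (R : realType)
    (I : T -> nat) (g : nat -> T -> R) :
  (forall i, measurable (I @^-1` [set i])) ->
  (forall i, measurable_fun setT (g i)) ->
  measurable_fun setT (fun x => g (I x) x).
Proof.
move=> mI mg _ B mB; rewrite setTI.
have -> : (fun x => g (I x) x) @^-1` B =
    \bigcup_i (I @^-1` [set i] `&` g i @^-1` B).
  apply/seteqP; split => [x Bx|x [i _ [/= <- Bx]]] //.
  by exists (I x).
apply: bigcup_measurable => i _; apply: measurableI => //.
by rewrite -[X in measurable X]setTI; exact: mg.
Qed.

Section exp_functional_theory.
Context d (Omega : measurableType d) (R : realType) (P : probability Omega R).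
Context (xi : R -> Omega -> R) (nu : {measure set R -> \bar R}).
Hypothesis hnu : levy_measure nu.
Hypothesis hxi : driftless_subordinator P xi nu.

Local Notation phi := (laplace_exponent nu).
Local Notation I := (exp_functional xi).
Local Notation K := (exp_functional_tail P xi).

#[local] Opaque laplace_exponent.

Let hsub : subordinator P xi := hxi.1.

(* The times [(trunc (r (n+1)) + 1) / (n+1)] decrease to [r] from the right, so
   right continuity makes [(w, r) |-> xi r w] a limit of jointly measurable
   functions. *)
Lemma subordinator_jointly_measurable :
  measurable_fun [set wr : Omega * R | 0 <= wr.2]
    (fun wr => expR (- xi wr.2 wr.1)).
Proof.
pose J (n : nat) (wr : Omega * R) := Num.truncn (wr.2 * n.+1%:R).
pose t (n i : nat) : R := i.+1%:R / n.+1%:R.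
apply: (@measurable_fun_cvg _ _ _ _
  (fun n wr => expR (- xi (t n (J n wr)) wr.1))).
  move=> n; apply: measurable_funTS.
  apply: (@measurable_nat_glue _ _ _ (J n) (fun i wr => expR (- xi (t n i) wr.1))).
    move=> i; have -> : J n @^-1` [set i] =
        snd @^-1` ((fun r : R => (Num.truncn (r * n.+1%:R))%:R : R) @^-1` [set i%:R]).
      apply/seteqP; split => wr /=; first by rewrite -/(J n wr) => ->.
      by rewrite /J => /eqP; rewrite eqr_nat => /eqP.
    have mt : measurable_fun setT (fun r : R => (Num.truncn (r * n.+1%:R))%:R : R).
      apply: nondecreasing_measurable => // r1 r2 r12; rewrite ler_nat.
      by apply: le_truncn; rewrite ler_wpM2r.
    have m1 := mt measurableT [set i%:R] (measurable_set1 _); rewrite setTI in m1.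
    by have := @measurable_snd _ _ Omega R measurableT _ m1; rewrite setTI.
  move=> i; have ti0 : 0 <= t n i by rewrite divr_ge0.
  have mx : measurable_fun setT (fun w => expR (- xi (t n i) w)).
    apply: measurableT_comp; first exact: measurable_expR.
    by apply: measurable_funN; exact: (sub_measurable hsub ti0).
  exact: (measurableT_comp mx measurable_fst).
move=> [w r] /= r0.
apply: (continuous_cvg _ (@continuous_expR R _)).
apply: cvgN.
have rc : xi u w @[u --> r^'+] --> xi r w := sub_right_continuous hsub r0.
move/cvg_at_rightP: rc; apply; split.
  move=> n; rewrite /t /J /= ltr_pdivlMr//; exact: truncnS_gt.
have le_t n : r <= t n (J n (w, r)) <= r + harmonic n.
  have n0 : (0 : R) < n.+1%:R by [].
  have /andP[t1 t2] := truncn_itv (mulr_ge0 r0 (ltW n0)).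
  rewrite /t /J /=; apply/andP; split.
    by rewrite ler_pdivlMr// ltW.
  rewrite ler_pdivrMr// /harmonic /= mulrDl mulVf ?lt0r_neq0// -natr1 lerD2r//.
apply: (@squeeze_cvgr _ _ _ _ (cst r) (fun n => r + harmonic n)).
- by apply: nearW => n; exact: le_t.
- exact: cvg_cst.
- by rewrite -[X in _ --> X]addr0; apply: cvgD; [exact: cvg_cst|exact: cvg_harmonic].
Qed.

(** Extension by zero to negative times lets Tonelli be applied on the full product space. *)
Let integrand (wr : Omega * R) : \bar R :=
  ((fun wr => expR (- xi wr.2 wr.1)) \_ [set wr : Omega * R | 0 <= wr.2] wr)%:E.

Let integrand_ge0 wr : (0 <= integrand wr)%E.
Proof. by rewrite lee_fin patchE; case: ifP => // _; exact: expR_ge0. Qed.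

Let integrandE (w : Omega) (r : R) :
  integrand (w, r) = ((fun r => (expR (- xi r w))%:E) \_ `[0, +oo[) r.
Proof.
rewrite /integrand !patchE /=.
have -> : ((w, r) \in [set wr : Omega * R | 0 <= wr.2]) = (r \in `[0, +oo[%classic).
  by apply/idP/idP; rewrite !inE /= in_itv /= andbT.
by case: ifP.
Qed.

Let measurable_integrand : measurable_fun setT integrand.
Proof.
apply/measurable_EFinP.
have mS : measurable [set wr : Omega * R | 0 <= wr.2].
  have -> : [set wr : Omega * R | 0 <= wr.2] = snd @^-1` `[0, +oo[%classic.
    by apply/seteqP; split => wr /=; rewrite in_itv /= andbT.
  have mi : measurable (`[0, +oo[%classic : set R) by exact: measurable_itv.
  by have := @measurable_snd _ _ Omega R measurableT _ mi; rewrite setTI.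
apply/(measurable_restrictT _ mS); exact: subordinator_jointly_measurable.
Qed.

Let exp_functionalE w : I w = (\int[lebesgue_measure]_r integrand (w, r))%E.
Proof.
rewrite /exp_functional integral_mkcond; apply: eq_integral => r _.
by rewrite integrandE.
Qed.

Lemma measurable_exp_functional : measurable_fun setT I.
Proof.
have h := @measurable_fun_fubini_tonelli_F _ _ _ _ _ lebesgue_measure _
  measurable_integrand integrand_ge0.
by apply: (eq_measurable_fun _ _ h) => w _; rewrite exp_functionalE.
Qed.

Lemma exp_functional_ge0 w : (0 <= I w)%E.
Proof. by rewrite exp_functionalE; exact: integral_ge0. Qed.

(** Tonelli reduces the mean to the integral of [e^(- r phi 1)] over [r >= 0], recognised as an
    exponential density up to the factor [1 / phi 1]. A finite mean yields, by Markov, that the tail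
    vanishes at infinity. *)
Lemma expectation_exp_functional :
  (\int[P]_w I w = ((phi 1)^-1)%:E)%E.
Proof.
have p0 := laplace_exponent_gt0 hnu (@ltr01 R).
under eq_integral do rewrite exp_functionalE.
rewrite (@fubini_tonelli _ _ _ _ _ P lebesgue_measure _ measurable_integrand
  integrand_ge0).
have E r : (\int[P]_w integrand (w, r) =
    ((phi 1)^-1)%:E * (exponential_pdf (phi 1) r)%:E)%E.
  rewrite /exponential_pdf -EFinM patchE; case: ifPn => [|rn].
    rewrite inE /= in_itv /= andbT => r0.
    rewrite mulKf ?lt0r_neq0//.
    have := hxi.2 r 1 r0 ler01; rewrite unlock => /=.
    rewrite mulNr (mulrC (phi 1)) => <-; apply: eq_integral => w _.
    by rewrite integrandE patchE mem_set /= ?in_itv /= ?andbT// mul1r.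
  rewrite mulr0 integral0_eq// => w _; rewrite integrandE patchE.
  by rewrite ifN.
under eq_integral do rewrite E.
rewrite ge0_integralZl_EFin//.
- by rewrite integral_exponential_pdf// mule1.
- by move=> r _; rewrite lee_fin exponential_pdf_ge0// ltW.
- by apply/measurable_EFinP; exact: measurable_exponential_pdf.
- by rewrite invr_ge0 ltW.
Qed.

Lemma measurable_tail_set (x : R) : measurable [set w | (x%:E < I w)%E].
Proof.
rewrite -[X in measurable X]setTI.
exact: (emeasurable_fun_o_infty measurableT measurable_exp_functional).
Qed.

Lemma exp_functional_tailE (x : R) :
  (K x)%:E = P [set w | (x%:E < I w)%E].
Proof.
rewrite /exp_functional_tail fineK// fin_num_measure//.
exact: measurable_tail_set.
Qed.

Lemma exp_functional_tail_ge0 (x : R) : 0 <= K x.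
Proof. by rewrite -lee_fin exp_functional_tailE. Qed.

Lemma exp_functional_tail_le (x y : R) : x <= y -> K y <= K x.
Proof.
move=> xy; rewrite -lee_fin !exp_functional_tailE le_measure ?inE//.
- exact: measurable_tail_set.
- exact: measurable_tail_set.
- by move=> w /=; apply: le_lt_trans; rewrite lee_fin.
Qed.

Lemma exp_functional_tail_markov (x : R) : 0 < x -> K x <= (phi 1)^-1 / x.
Proof.
move=> x0; rewrite ler_pdivlMr// mulrC -lee_fin EFinM exp_functional_tailE.
rewrite -expectation_exp_functional.
rewrite (eq_integral (fun w => `|I w|)%E); last first.
  by move=> w _; rewrite gee0_abs ?exp_functional_ge0.
apply: le_trans (le_integral_abse P measurableT measurable_exp_functional x0).
rewrite lee_wpmul2l ?lee_fin ?(ltW x0)// le_measure ?inE ?setTI//.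
- exact: measurable_tail_set.
- rewrite -[X in measurable X]setTI; apply: emeasurable_fun_c_infty => //.
  by apply: measurableT_comp => //; exact: measurable_exp_functional.
- by move=> w /= xI; rewrite gee0_abs ?exp_functional_ge0// ltW.
Qed.

End exp_functional_theory.

Section tail_equation.
Context d (Omega : measurableType d) (R : realType) (P : probability Omega R).
Context (xi : R -> Omega -> R) (nu : {measure set R -> \bar R}) (k : R -> R).
Hypothesis hnu : levy_measure nu.
Hypothesis hxi : driftless_subordinator P xi nu.
Hypothesis hk : exp_functional_density P xi nu k.

Local Notation phi := (laplace_exponent nu).
Local Notation I := (exp_functional xi).
Local Notation K := (exp_functional_tail P xi).

#[local] Opaque laplace_exponent.

Lemma tail_sub (x y : R) : 0 <= x -> x <= y ->
  (\int[lebesgue_measure]_(z in `]x, y]) (k z)%:E = (K x - K y)%:E)%E.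
Proof.
move=> x0 xy.
have mA : measurable (`]x, y]%classic : set R) by exact: measurable_itv.
have := density_law hk mA.
have -> : `]x, y]%classic `&` `[0%R, +oo[%classic = `]x, y]%classic :> set R.
  apply/setIidl => z /=; rewrite !in_itv /= andbT => /andP[xz _].
  by rewrite ltW// (le_lt_trans x0).
move=> <-; rewrite EFinB !(exp_functional_tailE hxi).
set A := [set w | exists2 _, _ & _].
have -> : A = [set w | (x%:E < I w)%E] `\` [set w | (y%:E < I w)%E].
  apply/seteqP; split => w /=.
    move=> [z zA ->]; move: zA; rewrite /= in_itv /= !lte_fin => /andP[-> zy].
    by split => //; apply/negP; rewrite -leNgt.
  move=> [xI /negP]; rewrite -leNgt => Iy.
  (* The law is tested on finite values only; [I w <= y] rules out [+oo]. *)
  have Ifin : I w \is a fin_num.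
    rewrite ge0_fin_numE ?(exp_functional_ge0 xi)//.
    exact: le_lt_trans Iy (ltry _).
  exists (fine (I w)); last by rewrite fineK.
  by rewrite /= in_itv /= -lte_fin -lee_fin fineK// xI.
have mx := measurable_tail_set hxi x; have my := measurable_tail_set hxi y.
rewrite measureD//=; last exact: le_lt_trans (probability_le1 P mx) (ltry _).
congr (_ - P _)%E; apply/setIidr => w /=; apply: le_lt_trans.
by rewrite lee_fin.
Qed.

Lemma density_integrable (x y : R) : 0 <= x -> x <= y ->
  lebesgue_measure.-integrable `]x, y] (EFin \o k).
Proof.
move=> x0 xy.
have sub : `]x, y]%classic `<=` (`[0, +oo[%classic : set R).
  move=> z /=; rewrite !in_itv /= andbT => /andP[xz _].
  by rewrite ltW// (le_lt_trans x0).
apply/integrableP; split.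
  apply/measurable_EFinP; apply: measurable_funS sub (density_measurable hk).
  exact: measurable_itv.
rewrite (@eq_integral _ _ _ lebesgue_measure _ (fun z => (k z)%:E)).
  by rewrite tail_sub// ltry.
move=> z; rewrite inE => /sub /=; rewrite in_itv /= andbT => z0.
by rewrite ger0_norm// (density_ge0 hk).
Qed.

Lemma continuous_density (x : R) : 0 < x -> {for x, continuous k}.
Proof.
move=> x0; have := density_smooth hk (n := 0%N) x0; rewrite derive1n0 => dk.
exact/differentiable_continuous/derivable1_diffP.
Qed.

(** Continuity of [k] is available only on the open half-line, so the fundamental theorem of
    calculus is applied from the base point [x / 2] instead of [0]. *)
Lemma is_derive_tail (x : R) : 0 < x -> is_derive x 1 K (- k x).
Proof.
move=> x0; have x20 : 0 < x / 2 by rewrite divr_gt0.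
have xx2 : x / 2 < x by rewrite ltr_pdivrMr// ltr_pMr// ltr1n.
have xx1 : x < x + 1 by rewrite ltrDl.
pose F z := \int[lebesgue_measure]_(t in `]x / 2, z]) k t.
have Fd : is_derive x 1 F (k x).
  have [d1 d2] := continuous_FTC1 (a := BRight (x / 2)) xx1
    (density_integrable (ltW x20) (ltW (lt_trans xx2 xx1)))
    xx2 (continuous_density x0).
  by split; [exact: d1|rewrite -derive1E; exact: d2].
have FE z : x / 2 <= z -> K (x / 2) - F z = K z.
  move=> xz; rewrite /F /Rintegral tail_sub ?(ltW x20)//=.
  by rewrite opprB addrC subrK.
have dd : is_derive x 1 (fun z => K (x / 2) - F z) (- k x).
  by apply: (is_derive_eq (is_deriveB (is_derive_cst (K (x / 2)) x 1) Fd)); rewrite sub0r.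
apply: near_eq_is_derive dd; near=> z; apply: FE.
by near: z; exact: lt_le_nbhsr.
Unshelve. all: end_near. Qed.

Lemma tail_integral_equation (x : R) : 0 < x ->
  ((k x)%:E = \int[nu]_(v in `]0%R, +oo[) (K x - K (x * expR v))%:E)%E.
Proof.
move=> x0; rewrite (density_eq hk x0); apply: eq_integral => v.
rewrite inE /= in_itv /= andbT => v0.
have xv : x <= x * expR v by rewrite ler_peMr ?(ltW x0)// -expR0 ler_expR ltW.
rewrite -tail_sub ?(ltW x0)// integral_itv_obnd_cbnd//.
exact: measurable_int (density_integrable (ltW x0) xv).
Qed.

Lemma exp_functional_ge (T : R) w : 0 <= T ->
  ((T * expR (- xi T w))%:E <= I w)%E.
Proof.
move=> T0; have hs := hxi.1.
have mI : measurable (`[0, T]%classic : set R) by exact: measurable_itv.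
have mI' : measurable (`[0, +oo[%classic : set R) by exact: measurable_itv.
have mx : measurable_fun (`[0, +oo[%classic : set R) (fun r => (expR (- xi r w))%:E).
  apply/measurable_EFinP.
  (* [xi] is unconstrained at negative times; clamping the time at [0] gives a function monotone on
     the whole line, hence measurable. *)
  have h : measurable_fun (`[0, +oo[%classic : set R)
      (fun r => expR (- xi (Num.max 0 r) w)).
    apply: nonincreasing_measurable => // r1 r2 r12.
    rewrite ler_expR lerN2; apply: (sub_nondecreasing hs).
      by rewrite le_max lexx.
    by rewrite ge_max !le_max lexx /= r12 orbT.
  apply: (eq_measurable_fun _ _ h) => r.
  by rewrite inE /= in_itv /= andbT => r0; rewrite (max_r r0).
apply: (@le_trans _ _ (\int[lebesgue_measure]_(r in `[0%R, T]) (expR (- xi T w))%:E)%E).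
  rewrite integral_cst//= lebesgue_measure_itv/= lte_fin.
  case: ltP => T0'; first by rewrite sube0 -EFinM mulrC.
  have -> : T = 0 by apply: le_anti; rewrite T0 T0'.
  by rewrite mul0r mule0.
apply: (@le_trans _ _ (\int[lebesgue_measure]_(r in `[0%R, T]) (expR (- xi r w))%:E)%E).
  apply: ge0_le_integral => //.
  - apply: measurable_funS mx => // r /=; rewrite !in_itv /= andbT.
    by case/andP.
  - move=> r /=; rewrite in_itv /= => /andP[r0 rT].
    by rewrite lee_fin ler_expR lerN2 (sub_nondecreasing hs).
apply: ge0_subset_integral => // r /=.
by rewrite !in_itv /= andbT => /andP[].
Qed.

(** If [xi T >= 1] almost surely, then [E[e^(- y xi_T)] <= e^-y], whereas this expectation is
    [e^(- T phi y) > e^-y]. *)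
Lemma subordinator_small_gt0 (T y : R) : 0 <= T -> 0 < y -> T * phi y < y ->
  (0 < P [set w | (xi T w < 1)%R])%E.
Proof.
move=> T0 y0 Ty; have hs := hxi.1.
have mxi := sub_measurable hs T0.
pose A := [set w | xi T w < 1].
have mA : measurable A.
  have := mxi measurableT `]-oo, 1[%classic (measurable_itv _).
  rewrite setTI; congr (measurable _); apply/seteqP; split => w /=;
  by rewrite in_itv.
have HE := hxi.2 T y T0 (ltW y0).
rewrite unlock /= in HE.
have mexp : measurable_fun setT (fun w => expR (- (y * xi T w))).
  apply: measurableT_comp; first exact: measurable_expR.
  by apply: measurable_funN; apply: measurable_funM.
have : (\int[P]_w (expR (- (y * xi T w)))%:E
    <= \int[P]_w (\1_A w + expR (- y))%:E)%E.
  apply: ge0_le_integral => //.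
  - exact/measurable_EFinP.
  - apply/measurable_EFinP; apply: measurable_funD => //.
  move=> w _; rewrite lee_fin indicE.
  have [xA|xA] := boolP (w \in A).
    rewrite -[leLHS]addr0 lerD ?expR_ge0// -expR0 ler_expR oppr_le0.
    rewrite mulr_ge0 ?(ltW y0)// -(sub_start hs w); exact: (sub_nondecreasing hs).
  rewrite add0r ler_expR lerN2 ler_peMr ?(ltW y0)// leNgt.
  by apply: contra xA => h; rewrite inE.
rewrite HE; under [leRHS]eq_integral do rewrite EFinD.
rewrite ge0_integralD//=; last first.
  by apply/measurable_EFinP; exact: measurable_indic.
rewrite integral_indic// setIT integral_cst//= probability_setT mule1.
rewrite lt0e measure_ge0 andbT => h; apply/eqP => A0; move: h.
rewrite A0 add0e lee_fin leNgt ltr_expR ltrN2 Ty//.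
Qed.

(** With [T = x e], the event [xi T < 1] forces [I >= T e^(- xi_T) > x]; it has positive probability
    once some [y] satisfies [y / phi y > T]. *)
Lemma tail_gt0 : (forall M, exists2 y, 0 < y & M <= y / phi y) ->
  forall x, 0 < x -> 0 < K x.
Proof.
move=> unb x x0; pose T := x * expR 1.
have T0 : 0 <= T by rewrite mulr_ge0 ?expR_ge0// ltW.
have [y y0 Ty] := unb (T + 1).
have p0 := laplace_exponent_gt0 hnu y0.
have Ty' : T * phi y < y.
  by rewrite -ltr_pdivlMr// (lt_le_trans _ Ty)// ltrDl.
have hs := hxi.1; have := subordinator_small_gt0 T0 y0 Ty'.
rewrite -lte_fin (exp_functional_tailE hxi) => /lt_le_trans; apply.
have mxi := sub_measurable hs T0.
rewrite le_measure ?inE//.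
- have := mxi measurableT `]-oo, 1[%classic (measurable_itv _).
  rewrite setTI; congr (measurable _); apply/seteqP; split => w /=;
  by rewrite in_itv.
- exact: (measurable_tail_set hxi).
- move=> w /= xw; apply: lt_le_trans (exp_functional_ge w T0).
  by rewrite lte_fin /T -mulrA -expRD ltr_pMr// -[ltLHS]expR0 ltr_expR subr_gt0.
Qed.

Lemma is_derive_neg_ln_tail (x : R) : 0 < x -> 0 < K x ->
  is_derive x 1 (fun x => - ln (K x)) (k x / K x).
Proof.
move=> x0 K0; have dK := is_derive_tail x0; have dl := is_derive1_ln K0.
have := @is_derive1_comp _ (@ln R) K x _ _ dl dK => dd.
have dd' : is_derive x 1 (fun x => ln (K x)) ((K x)^-1 * - k x) by exact: dd.
by apply: is_derive_eq; rewrite mulrN opprK mulrC.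
Qed.

End tail_equation.

(** * Sub- and supersolutions *)

Section trial_function.
Context (R : realType) (nu : {measure set R -> \bar R}).
Hypothesis hnu : levy_measure nu.
Context (e y0 : R).
Hypothesis e01 : 0 < e <= 1.
Hypothesis y02 : 2 <= y0.

Local Notation phi := (laplace_exponent nu).
Local Notation phi_ := (laplace_moment nu).
Local Notation s := (psi_exp nu).
Local Notation D := (`]0, +oo[%classic : set R).

Hypothesis eta_ge : forall y, y0 <= y -> e * phi y <= phi y - y * phi_ 1 y.

Let laplace_exponentE (y : R) :
  \int[nu]_(v in D) (1 - expR (- (y * v))) = phi y.
Proof. by []. Qed.

Let laplace_momentE (n : nat) (y : R) :
  \int[nu]_(v in D) (v ^+ n * expR (- (y * v))) = phi_ n y.
Proof. by []. Qed.

#[local] Opaque laplace_exponent laplace_moment.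

Let u0 : R := ln (y0 / phi y0).
Let c : R := 12 * e^-1 ^+ 4.
Let B : R := phase_error_bound c.
Let H := laplace_regular_phase hnu e01 y02 eta_ge.

Context (C : R).

Definition trial_phase : R -> R :=
  phase_fun (fun u => inv_amp_primitive nu (s u)) s
    (fun u => ln (eta nu (s u)) / 2) C.
Definition trial_slope (u : R) : R :=
  s u + second_order nu (s u) + C * rate nu (s u).
Local Notation g := trial_phase.
Local Notation p := trial_slope.

Let dg (u : R) : u0 <= u -> is_derive u 1 g (p u).
Proof. by move=> uu; exact: (is_derive_phase_fun H C uu). Qed.

Section at_point.
Context (u : R).
Hypothesis uu : u0 <= u.
Hypothesis Cs : `|C| * c <= s u.

Let L (v : R) : R := v * second_order nu (s u) + C * v * rate nu (s u)
  + v ^+ 2 / 2 * vel nu (s u).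
Let er (v : R) : R := exp_error (s u) v (g (u + v) - g u) (L v).

Let er_le (v : R) : 0 < v ->
  `|er v| <= B / s u ^+ 2 * (1 - expR (- (s u * v))).
Proof. by move=> v0; exact: (phase_exp_error H uu v0 Cs). Qed.

Let sp : 0 < s u.
Proof. by apply: lt_le_trans (phase_ge2 H uu). Qed.

Let mD : measurable D. Proof. exact: measurable_itv. Qed.

Let measurable_increment :
  measurable_fun D (fun v => 1 - expR (- (g (u + v) - g u))).
Proof.
apply: open_continuous_measurable_fun; first exact: interval_open.
move=> v; rewrite inE /= in_itv /= andbT => v0.
have uv : u0 <= u + v by rewrite (le_trans uu)// lerDl ltW.
have d1 := dg uv.
have d2 : is_derive v 1 (fun v => u + v) 1.
  apply: (is_derive_eq (is_deriveD (is_derive_cst u v 1) (is_derive_id v 1))).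
  by rewrite add0r.
have d3 : is_derive v 1 (fun v => g (u + v)) (p (u + v) * 1).
  exact: (@is_derive1_comp _ g (fun v => u + v) v _ _ d1 d2).
have d4 : is_derive v 1 (fun v => 1 - expR (- (g (u + v) - g u)))
    (expR (- (g (u + v) - g u)) * (p (u + v) * 1)).
  by apply: is_derive_eq; rewrite /GRing.scale/=; ring.
exact: is_derive_continuous d4.
Qed.

Let increment_split (v : R) : 1 - expR (- (g (u + v) - g u)) =
  (1 - expR (- (s u * v))) + ((second_order nu (s u) + C * rate nu (s u)) *
   (v ^+ 1 * expR (- (s u * v))) +
  (vel nu (s u) / 2 * (v ^+ 2 * expR (- (s u * v))) + er v)).
Proof. by rewrite /er /exp_error /L; field. Qed.

Let measurable_er : measurable_fun D er.
Proof.
have -> : er = (fun v => 1 - expR (- (g (u + v) - g u))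
  - ((1 - expR (- (s u * v))) + ((second_order nu (s u) + C * rate nu (s u)) *
   (v ^+ 1 * expR (- (s u * v))) +
   vel nu (s u) / 2 * (v ^+ 2 * expR (- (s u * v)))))).
  by apply/funext => v; rewrite increment_split; ring.
apply: measurable_funB => //.
apply: measurable_funD.
  by apply: measurable_funB => //; exact: measurable_expRNM.
apply: measurable_funD; apply: measurable_funM => //; exact: measurable_moment.
Qed.

Let i_exp := levy_integrable_exp hnu (ltW sp).
Let i_er : nu.-integrable D (EFin \o er).
Proof. exact: (levy_dominated_integrable hnu (ltW sp) measurable_er er_le). Qed.

Let i_lin (n : nat) (a : R) :
  nu.-integrable D (EFin \o (fun v => a * (v ^+ n.+1 * expR (- (s u * v))))).
Proof. exact: (integrableZl mD a (moment_integrable hnu n sp)). Qed.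

Lemma trial_increment_integrable :
  nu.-integrable D (EFin \o (fun v => 1 - expR (- (g (u + v) - g u)))).
Proof.
rewrite (_ : (fun v => _) = (fun v => (1 - expR (- (s u * v))) +
  ((second_order nu (s u) + C * rate nu (s u)) * (v ^+ 1 * expR (- (s u * v))) +
  (vel nu (s u) / 2 * (v ^+ 2 * expR (- (s u * v))) + er v)))).
  exact: (integrableD mD i_exp (integrableD mD (i_lin 0 _)
    (integrableD mD (i_lin 1 _) i_er))).
by apply/funext => v; exact: increment_split.
Qed.

(** Integrating [increment_split] term by term and using [e^u = s / phi s], the terms [phi s]
    cancel, [second_order] balances the second moment, and the [C] terms combine to [C phi s / s^2].
    What remains is minus the integral of [er]. *)
Lemma trial_slope_residual :
  `|p u / expR u - \int[nu]_(v in D) (1 - expR (- (g (u + v) - g u)))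
    - C * (phi (s u) / s u ^+ 2)| <= B * (phi (s u) / s u ^+ 2).
Proof.
have p0 := laplace_exponent_gt0 hnu sp; have h0 := eta_gt0 hnu sp.
have [_ <-] := psi_exp_spec hnu e01 y02 eta_ge uu.
rewrite (@eq_Rintegral _ _ _ nu D (fun v => (1 - expR (- (s u * v))) +
  ((second_order nu (s u) + C * rate nu (s u)) * (v ^+ 1 * expR (- (s u * v))) +
  (vel nu (s u) / 2 * (v ^+ 2 * expR (- (s u * v))) + er v)))); last first.
  by move=> v _; exact: increment_split.
have j1 := integrableD mD (i_lin 1 (vel nu (s u) / 2)) i_er.
have j2 := integrableD mD (i_lin 0 (second_order nu (s u) + C * rate nu (s u))) j1.
rewrite (RintegralD mD i_exp j2) (RintegralD mD (i_lin 0 _) j1).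
rewrite (RintegralD mD (i_lin 1 _) i_er).
rewrite (RintegralZl _ mD (moment_integrable hnu 0 sp)).
rewrite (RintegralZl _ mD (moment_integrable hnu 1 sp)).
rewrite laplace_exponentE !laplace_momentE.
have := levy_dominated_le hnu (ltW sp) measurable_er er_le.
rewrite -normrN mulrAC -mulrA; apply: le_trans; rewrite le_eqVlt; apply/orP; left.
apply/eqP; congr (`|_|).
set E := \int[nu]_(_ in _) er _.
move: h0; rewrite /trial_slope /second_order /vel /rate /amp /eta => h0.
by field; rewrite !lt0r_neq0.
Qed.

Let rho_gt0 : 0 < phi (s u) / s u ^+ 2.
Proof. by rewrite divr_gt0 ?exprn_gt0// laplace_exponent_gt0. Qed.

Lemma trial_slope_gt : B < C ->
  \int[nu]_(v in D) (1 - expR (- (g (u + v) - g u))) < p u / expR u.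
Proof.
move=> BC; have := trial_slope_residual; rewrite ler_norml => /andP[h _].
have : B * (phi (s u) / s u ^+ 2) < C * (phi (s u) / s u ^+ 2).
  by rewrite ltr_pM2r.
move: h; set E := Rintegral _ _ _; set F := p u / _; set r := phi _ / _.
by lra.
Qed.

Lemma trial_slope_lt : C < - B ->
  p u / expR u < \int[nu]_(v in D) (1 - expR (- (g (u + v) - g u))).
Proof.
move=> BC; have := trial_slope_residual; rewrite ler_norml => /andP[_ h].
have : C * (phi (s u) / s u ^+ 2) < - B * (phi (s u) / s u ^+ 2).
  by rewrite ltr_pM2r.
move: h; set E := Rintegral _ _ _; set F := p u / _; set r := phi _ / _.
by lra.
Qed.

Lemma trial_phase_ge (w : R) : u <= w -> g u + (w - u) <= g w.
Proof. by move=> uw; exact: (phase_fun_ge H uu uw Cs). Qed.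

End at_point.

Lemma is_derive_trial_phase (u : R) : u0 <= u -> is_derive u 1 g (p u).
Proof. exact: dg. Qed.

(** [s] equals [y1] at [ln (y1 / phi y1)] and is nondecreasing from there on. *)
Lemma trial_phase_threshold : exists2 u1, u0 <= u1 &
  forall u, u1 <= u -> `|C| * c <= s u.
Proof.
pose y1 := Num.max y0 (`|C| * c).
have yp : 0 < y0 by apply: lt_le_trans y02.
have y1p : 0 < y1 by rewrite lt_max yp.
have y01 : y0 / phi y0 <= y1 / phi y1.
  have : y0 <= y1 by rewrite /y1 le_max lexx.
  rewrite le_eqVlt => /predU1P[<-//|].
  by move=> h; apply: ltW; exact: ratio_lt.
have x0 := divr_gt0 yp (laplace_exponent_gt0 hnu yp).
have x1 := divr_gt0 y1p (laplace_exponent_gt0 hnu y1p).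
have u01 : u0 <= ln (y1 / phi y1).
  by rewrite ler_ln ?posrE; [exact: y01|exact: x0|exact: x1].
exists (ln (y1 / phi y1)); first exact: u01.
move=> u u1u.
apply: le_trans (phase_nondecreasing H u01 u1u).
have -> : s (ln (y1 / phi y1)) = y1.
  by rewrite /psi_exp lnK ?posrE// psi_ratio.
by rewrite /y1 le_max lexx orbT.
Qed.

End trial_function.

(** * Pointwise bounds on the hazard rate *)

Section hazard_rate.
Context d (Omega : measurableType d) (R : realType) (P : probability Omega R).
Context (xi : R -> Omega -> R) (nu : {measure set R -> \bar R}) (k : R -> R).
Hypothesis hnu : levy_measure nu.
Hypothesis hxi : driftless_subordinator P xi nu.
Hypothesis hk : exp_functional_density P xi nu k.
Context (e y0 : R).
Hypothesis e01 : 0 < e <= 1.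
Hypothesis y02 : 2 <= y0.

Local Notation phi := (laplace_exponent nu).
Local Notation phi_ := (laplace_moment nu).
Local Notation s := (psi_exp nu).
Local Notation D := (`]0, +oo[%classic : set R).
Local Notation K := (exp_functional_tail P xi).

Hypothesis eta_ge : forall y, y0 <= y -> e * phi y <= phi y - y * phi_ 1 y.

#[local] Opaque laplace_exponent laplace_moment.

Let u0 : R := ln (y0 / phi y0).
Let c : R := 12 * e^-1 ^+ 4.
Let B : R := phase_error_bound c.

Let mD : measurable D. Proof. exact: measurable_itv. Qed.

Lemma exp_functional_tail_gt0 (x : R) : 0 < x -> 0 < K x.
Proof.
apply: (tail_gt0 hnu hxi) => M.
have [y yy My] := ratio_unbounded hnu e01 y02 eta_ge M.
by exists y => //; apply: lt_le_trans yy; apply: lt_le_trans y02.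
Qed.

Let jump_measurable (x : R) : 0 < x -> measurable_fun D (fun v => K x - K (x * expR v)).
Proof.
move=> x0; apply: nondecreasing_measurable => // v1 v2 v12.
rewrite lerD2l lerN2 (exp_functional_tail_le hxi)//.
by rewrite ler_wpM2l ?(ltW x0)// ler_expR.
Qed.

Lemma tail_jump_integrable (x : R) : 0 < x ->
  nu.-integrable D (EFin \o (fun v => K x - K (x * expR v))).
Proof.
move=> x0; apply/integrableP; split.
  by apply/measurable_EFinP; exact: jump_measurable.
rewrite (@eq_integral _ _ _ nu _ (fun v => (K x - K (x * expR v))%:E)).
  by rewrite -(tail_integral_equation hxi hk x0) ltry.
move=> v; rewrite inE /= in_itv /= andbT => v0.
rewrite ger0_norm// subr_ge0 (exp_functional_tail_le hxi)//.
by rewrite ler_peMr ?(ltW x0)// -expR0 ler_expR ltW.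
Qed.

Lemma density_jumpE (x : R) : 0 < x ->
  k x = \int[nu]_(v in D) (K x - K (x * expR v)).
Proof. by move=> x0; rewrite /Rintegral -(tail_integral_equation hxi hk x0). Qed.

Lemma tail_vanishes (r : R) : 0 < r -> exists X, forall y, X <= y -> K y < r.
Proof.
move=> r0; have p0 := laplace_exponent_gt0 hnu (@ltr01 R).
have q0 : 0 < (phi 1)^-1 / r + 1.
  by rewrite ltr_wpDl// divr_ge0 ?(ltW r0)// invr_ge0 ltW.
exists ((phi 1)^-1 / r + 1) => y Xy; have y0' := lt_le_trans q0 Xy.
apply: le_lt_trans (exp_functional_tail_markov hnu hxi y0') _.
rewrite ltr_pdivrMr// mulrC -ltr_pdivrMr// (lt_le_trans _ Xy)//.
by rewrite ltrDl.
Qed.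

Section comparison.
Context (C : R).

Local Notation g := (trial_phase nu C).
Local Notation p := (trial_slope nu C).

Let h (x : R) : R := expR (- g (ln x)).

Let dh (x : R) : 0 < x -> u0 <= ln x ->
  is_derive x 1 h (- (h x * (p (ln x) / x))).
Proof.
move=> x0 ux; have d1 := is_derive_trial_phase hnu e01 y02 eta_ge C ux.
have d2 := is_derive1_ln x0.
have d3 : is_derive x 1 (fun x => g (ln x)) (p (ln x) * x^-1).
  exact: (@is_derive1_comp _ g (@ln R) x _ _ d1 d2).
by apply: is_derive_eq; rewrite /h /GRing.scale/=; ring.
Qed.

Let h_jump (x v : R) : 0 < x ->
  h x - h (x * expR v) = h x * (1 - expR (- (g (ln x + v) - g (ln x)))).
Proof.
move=> x0; rewrite /h lnM ?posrE ?expR_gt0// expRK mulrBr mulr1 -expRD.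
by congr (_ - expR _); ring.
Qed.

Let h_jump_integral (a x : R) : 0 < x -> u0 <= ln x -> `|C| * c <= s (ln x) ->
  nu.-integrable D (EFin \o (fun v => a * h x - a * h (x * expR v))) /\
  \int[nu]_(v in D) (a * h x - a * h (x * expR v)) =
  a * h x * \int[nu]_(v in D) (1 - expR (- (g (ln x + v) - g (ln x)))).
Proof.
move=> x0 ux Cs.
have i0 := trial_increment_integrable hnu e01 y02 eta_ge ux Cs.
have E : (fun v => a * h x - a * h (x * expR v)) =
    (fun v => a * h x * (1 - expR (- (g (ln x + v) - g (ln x))))).
  by apply/funext => v; rewrite -mulrBr h_jump// mulrA.
rewrite E; split; first exact: (integrableZl mD (a * h x) i0).
by rewrite RintegralZl.
Qed.

Let threshold : exists2 x1, 0 < x1 & forall x, x1 <= x ->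
  u0 <= ln x /\ `|C| * c <= s (ln x).
Proof.
have [u1 u01 Cs] := trial_phase_threshold hnu e01 y02 eta_ge C.
exists (expR u1); first exact: expR_gt0.
move=> x u1x; have x0 : 0 < x by apply: lt_le_trans u1x; exact: expR_gt0.
have u1x' : u1 <= ln x by rewrite -[u1]expRK ler_ln ?posrE ?expR_gt0.
by split; [exact: le_trans u1x'|exact: Cs].
Qed.

(** [trial_phase_ge] gives [h y <= h x * x / y] for [y >= x]. *)
Let h_vanishes (a x r : R) : 0 < a -> 0 < x -> u0 <= ln x ->
  `|C| * c <= s (ln x) -> 0 < r -> exists X, forall y, X <= y -> a * h y < r.
Proof.
move=> a0 x0 ux Cs r0; pose A := a * (h x * x).
have h0 : 0 < h x := expR_gt0 _.
have A0 : 0 < A by rewrite !mulr_gt0.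
exists (Num.max x (A / r + 1)) => y; rewrite ge_max => /andP[xy Ay].
have yp : 0 < y by apply: lt_le_trans xy.
have lxy : ln x <= ln y by rewrite ler_ln ?posrE.
have gg := trial_phase_ge hnu e01 y02 eta_ge ux Cs lxy.
apply: (@le_lt_trans _ _ (A / y)).
  rewrite /A -mulrA ler_wpM2l ?(ltW a0)// /h.
  rewrite -{2}(lnK (x := x)) ?posrE// -{2}(lnK (x := y)) ?posrE//.
  rewrite -expRN -!expRD ler_expR.
  by move: gg; set a1 := g _; set a2 := g _; set a3 := ln x; set a4 := ln y; lra.
rewrite ltr_pdivrMr// mulrC -ltr_pdivrMr//; apply: lt_le_trans Ay.
by rewrite ltrDl.
Qed.

Lemma hazard_rate_le : B < C ->
  \forall x \near +oo, k x / K x <= p (ln x) / x.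
Proof.
move=> BC; have [x1 x10 Hx1] := threshold.
near=> x; have x1x : x1 <= x by near: x; apply: nbhs_pinfty_ge; exact: num_real.
have x0 : 0 < x by exact: lt_le_trans x1x.
have [ux Cs] := Hx1 _ x1x.
have hx0 : 0 < h x := expR_gt0 _.
have Kx0 := exp_functional_tail_gt0 x0.
(* Rescaling makes the trial function touch [K] exactly at [x], so the ordering beyond [x] passes to
   the derivatives there. *)
pose a := K x / h x; have a0 : 0 < a by rewrite divr_gt0.
have pos y : x <= y -> 0 < y by exact: lt_le_trans.
have Hy y : x <= y -> u0 <= ln y /\ `|C| * c <= s (ln y).
  by move=> xy; apply: Hx1; exact: le_trans xy.
have da y : x <= y ->
    is_derive y 1 (fun y => a * h y) (- (a * h y * (p (ln y) / y))).
  move=> xy; have [uy _] := Hy _ xy; have := dh (pos _ xy) uy => ?.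
  by apply: is_derive_eq; rewrite /GRing.scale/=; ring.
have dK y : x <= y -> is_derive y 1 K (- k y).
  by move=> xy; exact: (is_derive_tail hxi hk (pos _ xy)).
have ax : a * h x = K x by rewrite /a divfK// lt0r_neq0.
have aK : forall y, x <= y -> a * h y <= K y.
  apply: (comparison_principle da dK).
  - by rewrite ax.
  - move=> r r0; have [X HX] := h_vanishes a0 x0 ux Cs r0.
    exists X => y /HX; apply: le_lt_trans.
    by rewrite lerBlDr lerDl (exp_functional_tail_ge0 hxi).
  (* Integrating the jump comparison bounds [k y] by the integrated jumps of [a * h], which are
     strictly below minus the derivative of [a * h] since [B < C]. *)
  move=> y xy jmp; have yp := pos _ (ltW xy); have [uy Csy] := Hy _ (ltW xy).
  have [i1 E1] := h_jump_integral a yp uy Csy.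
  have := le_Rintegral mD (tail_jump_integrable yp) i1.
  rewrite -(density_jumpE yp) E1 => le1.
  have := trial_slope_gt hnu e01 y02 eta_ge uy Csy BC.
  rewrite lnK ?posrE// => lt1.
  apply/eqP; rewrite eqr_opp gt_eqF//; apply: le_lt_trans (le1 _) _.
    move=> v; rewrite /= in_itv /= andbT => v0; apply: jmp.
    by rewrite ltr_pMr// -expR0 ltr_expR.
  rewrite ltr_pM2l; first exact: lt1.
  exact: mulr_gt0 a0 (expR_gt0 _).
have := is_derive_touching_le (da x (lexx x)) (dK x (lexx x)) ax aK.
by rewrite lerN2 ax ler_pdivrMr// mulrC.
Unshelve. all: end_near. Qed.

(** The mirror case: [K] is now the lower function in the comparison, and its vanishing at infinity
    is the one that matters. *)
Lemma hazard_rate_ge : C < - B ->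
  \forall x \near +oo, p (ln x) / x <= k x / K x.
Proof.
move=> BC; have [x1 x10 Hx1] := threshold.
near=> x; have x1x : x1 <= x by near: x; apply: nbhs_pinfty_ge; exact: num_real.
have x0 : 0 < x by exact: lt_le_trans x1x.
have [ux Cs] := Hx1 _ x1x.
have hx0 : 0 < h x := expR_gt0 _.
have Kx0 := exp_functional_tail_gt0 x0.
pose a := K x / h x; have a0 : 0 < a by rewrite divr_gt0.
have pos y : x <= y -> 0 < y by exact: lt_le_trans.
have Hy y : x <= y -> u0 <= ln y /\ `|C| * c <= s (ln y).
  by move=> xy; apply: Hx1; exact: le_trans xy.
have da y : x <= y ->
    is_derive y 1 (fun y => a * h y) (- (a * h y * (p (ln y) / y))).
  move=> xy; have [uy _] := Hy _ xy; have := dh (pos _ xy) uy => ?.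
  by apply: is_derive_eq; rewrite /GRing.scale/=; ring.
have dK y : x <= y -> is_derive y 1 K (- k y).
  by move=> xy; exact: (is_derive_tail hxi hk (pos _ xy)).
have ax : K x = a * h x by rewrite /a divfK// lt0r_neq0.
have aK : forall y, x <= y -> K y <= a * h y.
  apply: (comparison_principle dK da).
  - by rewrite ax.
  - move=> r r0; have [X HX] := tail_vanishes r0.
    exists X => y /HX; apply: le_lt_trans.
    by rewrite lerBlDr lerDl mulr_ge0 ?expR_ge0// ltW.
  move=> y xy jmp; have yp := pos _ (ltW xy); have [uy Csy] := Hy _ (ltW xy).
  have [i1 E1] := h_jump_integral a yp uy Csy.
  have := le_Rintegral mD i1 (tail_jump_integrable yp).
  rewrite -(density_jumpE yp) E1 => le1.
  have := trial_slope_lt hnu e01 y02 eta_ge uy Csy BC.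
  rewrite lnK ?posrE// => lt1.
  apply/eqP; rewrite eqr_opp gt_eqF//; apply: lt_le_trans (le1 _).
    rewrite ltr_pM2l; first exact: lt1.
    exact: mulr_gt0 a0 (expR_gt0 _).
  move=> v; rewrite /= in_itv /= andbT => v0; apply: jmp.
  by rewrite ltr_pMr// -expR0 ltr_expR.
have := is_derive_touching_le (dK x (lexx x)) (da x (lexx x)) ax aK.
by rewrite lerN2 -ax ler_pdivlMr// mulrC.
Unshelve. all: end_near. Qed.

End comparison.

(** The two choices [C = B + 1] and [C = - (B + 1)] give slopes that differ only in the [rate]
    term. *)
Lemma hazard_rate_asymptotics : \forall x \near +oo,
  `|k x / K x - (s (ln x) + second_order nu (s (ln x))) / x|
  <= (B + 1) * (rate nu (s (ln x)) / x).
Proof.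
have lt1 : B < B + 1 by rewrite ltrDl.
have lt2 : - (B + 1) < - B by rewrite ltrN2.
near=> x; have h1 : k x / K x <= trial_slope nu (B + 1) (ln x) / x.
  by near: x; exact: hazard_rate_le.
have h2 : trial_slope nu (- (B + 1)) (ln x) / x <= k x / K x.
  by near: x; exact: hazard_rate_ge.
move: h1 h2; rewrite /trial_slope.
move: (s (ln x) + second_order nu (s (ln x))) (rate nu (s (ln x))) (k x / K x) (B + 1).
move=> a r b C h1 h2; rewrite ler_norml.
move: h1 h2; rewrite !(mulrDl a) !mulNr -(mulrA C).
by move=> h1 h2; rewrite lerBrDl h2 lerBlDl h1.
Unshelve. all: end_near. Qed.

End hazard_rate.

(** * Conclusion *)

Section psi_expansion.
Context (R : realType) (nu : {measure set R -> \bar R}).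
Hypothesis hnu : levy_measure nu.
Context (e y0 : R).
Hypothesis e01 : 0 < e <= 1.
Hypothesis y02 : 2 <= y0.

Local Notation phi := (laplace_exponent nu).
Local Notation phi_ := (laplace_moment nu).
Local Notation psi := (psi_of phi).

Hypothesis eta_ge : forall y, y0 <= y -> e * phi y <= phi y - y * phi_ 1 y.

#[local] Opaque laplace_exponent laplace_moment.

Lemma is_derive_psi_vel (x : R) : y0 / phi y0 <= x ->
  is_derive x 1 psi (vel nu (psi x) / x).
Proof.
move=> xx; have [ys E] := psi_spec hnu e01 y02 eta_ge xx.
have sp : 0 < psi x by apply: lt_le_trans ys; apply: lt_le_trans y02.
apply: (is_derive_eq (is_derive_psi hnu e01 y02 eta_ge xx)).
have p0 := laplace_exponent_gt0 hnu sp; have h0 := eta_gt0 hnu sp.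
move: (psi x) E sp p0 h0 => y <- sp p0; rewrite /vel /amp /eta => h0.
by field; rewrite !lt0r_neq0.
Qed.

(** The strict inequality leaves a neighbourhood of [x] in which [is_derive_psi_vel] gives the first
    derivative. *)
Lemma is_derive_psi_derive (x : R) : y0 / phi y0 < x ->
  is_derive x 1 psi^`()%classic
    (vel nu (psi x) * (vel1 nu (psi x) - 1) / x ^+ 2).
Proof.
move=> xx.
have yp : 0 < y0 by apply: lt_le_trans y02.
have x0 : 0 < x.
  by apply: le_lt_trans xx; rewrite divr_ge0 ?(ltW yp)// ltW// laplace_exponent_gt0.
have [ys _] := psi_spec hnu e01 y02 eta_ge (ltW xx).
have sp : 0 < psi x by apply: lt_le_trans ys.
have dv : is_derive x 1 (fun z => vel nu (psi z))
    (vel1 nu (psi x) * (vel nu (psi x) / x)).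
  exact: (@is_derive1_comp _ (vel nu) psi x _ _ (is_derive_vel hnu sp)
    (is_derive_psi_vel (ltW xx))).
have dd := is_derive_div (g := id) (lt0r_neq0 x0) dv (is_derive_id x 1).
have dd' : is_derive x 1 (fun z => vel nu (psi z) / z)
    (vel nu (psi x) * (vel1 nu (psi x) - 1) / x ^+ 2).
  by apply: (is_derive_eq dd); field; rewrite lt0r_neq0.
apply: near_eq_is_derive dd'; near=> z.
have xz : y0 / phi y0 <= z by near: z; exact: lt_le_nbhsr.
by have [_ <-] := is_derive_psi_vel xz; rewrite derive1E.
Unshelve. all: end_near. Qed.

(** Here [psi' = vel / x] and [psi'' / (2 psi') = (vel1 - 1) / (2 x)]. With [h = amp] and
    [rj = y^j phi_j / phi], one has [vel1 = h + h r1 - h^2 r2] and [h (1 - r1) = 1], so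
    [h - 1 - (vel1 - 1) / 2] reduces to [h^2 r2 / 2], which is [second_order]. *)
Lemma psi_expansionE (x : R) : y0 / phi y0 < x ->
  psi x / x + psi^`()%classic x / psi x - x^-1
    - psi^`(2)%classic x / (2 * psi^`()%classic x)
  = (psi x + second_order nu (psi x)) / x.
Proof.
move=> xx.
have yp : 0 < y0 by apply: lt_le_trans y02.
have x0 : 0 < x.
  by apply: le_lt_trans xx; rewrite divr_ge0 ?(ltW yp)// ltW// laplace_exponent_gt0.
have [ys _] := psi_spec hnu e01 y02 eta_ge (ltW xx).
have sp : 0 < psi x by apply: lt_le_trans ys.
rewrite derive1Sn derive1n1.
have [_ E2] := is_derive_psi_derive xx; rewrite [X in X / (2 * _)]derive1E E2.
have [_ E1] := is_derive_psi_vel (ltW xx); rewrite derive1E E1.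
have p0 := laplace_exponent_gt0 hnu sp; have h0 := eta_gt0 hnu sp.
move: (psi x) sp p0 h0 => y sp p0.
rewrite /vel1 /second_order /vel /amp1 /amp.
have etaE : eta nu y = phi y - y * phi_ 1 y by [].
(* Eliminating the first moment in favour of [eta] encodes the relation [h (1 - r1) = 1], after
   which the identity is purely rational. *)
have -> : phi_ 1 y = (phi y - eta nu y) / y by rewrite etaE; field; rewrite lt0r_neq0.
by move=> h0; field; rewrite !lt0r_neq0.
Qed.

Lemma psi_errorE (x : R) : y0 / phi y0 < x ->
  psi^`()%classic x / psi x ^+ 2 = rate nu (psi x) / x.
Proof.
move=> xx.
have yp : 0 < y0 by apply: lt_le_trans y02.
have x0 : 0 < x.
  by apply: le_lt_trans xx; rewrite divr_ge0 ?(ltW yp)// ltW// laplace_exponent_gt0.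
have [ys _] := psi_spec hnu e01 y02 eta_ge (ltW xx).
have sp : 0 < psi x by apply: lt_le_trans ys.
have [_ E1] := is_derive_psi_vel (ltW xx); rewrite derive1E E1 /rate /vel.
by field; rewrite !lt0r_neq0.
Qed.

End psi_expansion.

Theorem proposition8 (R : realType) (d : measure_display)
    (Omega : measurableType d) (P : probability Omega R)
    (xi : R -> Omega -> R) (nu : {measure set R -> \bar R}) (k : R -> R)
    (hnu : levy_measure nu) (hxi : driftless_subordinator P xi nu)
    (hk : exp_functional_density P xi nu k)
    (hphi : (limf_esup (fun x : R =>
        (x * (laplace_exponent nu)^`()%classic x / laplace_exponent nu x)%:E)
        (pinfty_nbhs R) < 1)%E) :
  let psi := psi_of (laplace_exponent nu) in
  let f := fun x : R => - ln (exp_functional_tail P xi x) in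
  (forall x : R, 0 < x ->
     is_derive x 1 f (k x / exp_functional_tail P xi x)) /\
  f^`() =
    (fun x : R => psi x / x + psi^`()%classic x / psi x - x^-1
                  - psi^`(2)%classic x / (2 * psi^`()%classic x))
    +O_ (pinfty_nbhs R) (fun x : R => psi^`()%classic x / psi x ^+ 2).
Proof.
move=> psi f.
have [e [y0 [e01 y02 eta_ge]]] := laplace_limsup_lt1 hnu hphi.
have fd (x : R) : 0 < x -> is_derive x 1 f (k x / exp_functional_tail P xi x).
  move=> x0; apply: (is_derive_neg_ln_tail hxi hk x0).
  exact: (exp_functional_tail_gt0 hnu hxi e01 y02 eta_ge x0).
split; first exact: fd.
have asymp := hazard_rate_asymptotics hnu hxi hk e01 y02 eta_ge.
apply/eqaddOP; near=> C; near=> x.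
have x0 : 0 < x by near: x; apply: nbhs_pinfty_gt; exact: num_real.
have xx : y0 / laplace_exponent nu y0 < x.
  by near: x; apply: nbhs_pinfty_gt; exact: num_real.
have BC : phase_error_bound (12 * e^-1 ^+ 4) + 1 <= C.
  by near: C; apply: nbhs_pinfty_ge; exact: num_real.
have : `|k x / exp_functional_tail P xi x - (psi x + second_order nu (psi x)) / x|
    <= (phase_error_bound (12 * e^-1 ^+ 4) + 1) * (rate nu (psi x) / x).
  have {1 2 3}-> : psi x = psi_exp nu (ln x) by rewrite /psi_exp lnK ?posrE.
  by near: x.
rewrite (psi_errorE hnu e01 y02 eta_ge xx) => h.
have -> : (f^`()%classic - (fun x : R => psi x / x + psi^`()%classic x / psi x - x^-1
                  - psi^`(2)%classic x / (2 * psi^`()%classic x))) x =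
    k x / exp_functional_tail P xi x - (psi x + second_order nu (psi x)) / x.
  rewrite -(psi_expansionE hnu e01 y02 eta_ge xx) -/psi.
  by have [_ <-] := fd _ x0; rewrite -derive1E.
have [ys _] := psi_spec hnu e01 y02 eta_ge (ltW xx).
have sp : 0 < psi x by apply: lt_le_trans ys; apply: lt_le_trans y02.
have r0 : 0 <= rate nu (psi x) / x.
  by rewrite !divr_ge0 ?(ltW x0) ?(ltW sp) ?ltW ?eta_gt0 ?laplace_exponent_gt0.
by rewrite (ger0_norm r0); apply: (le_trans h); apply: ler_wpM2r.
Unshelve. all: end_near. Qed.
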